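(* Let $m<\infty$ be fixed and let $z$ be a binary string of length $l\le m$. Let the data $D$ be sampled i.i.d. from the true distribution $\dot q$ on $\Gamma$. Then the posterior of $\vec q_{z*}$ concentrates for $n_z\to\infty$ around the true value $\dot{\vec q}_{z*}=(\dot q_{zy}:y\in\mathbb B_1^{m-l})$ with probability 1, i.e. with probability 1, as $n_z\to\infty$, $$p_z(\vec q_{z*}|D_z)\;\longrightarrow\;\prod_{y\in\mathbb B_1^{m-l}}\delta(q_{zy}-\dot q_{zy})$$ in the topology of weak convergence (convergence in distribution).
   Context: Tree partition. $\Gamma$ is a sample space of total volume $|\Gamma|=1$, $m$ is a finite tree height, and $\mathbb B_k^m=\bigcup_{i=k}^m\{0,1\}^i$ is the set of binary strings of length between $k$ and $m$ (empty if $k>m$). For each $z\in\mathbb B_0^m$ there is a set $\Gamma_z\subseteq\Gamma$, with $\Gamma_\epsilon=\Gamma$ for the empty string $\epsilon$, and for $\ell(z)<m$ the set $\Gamma_z$ is the disjoint union of $\Gamma_{z0}$ and $\Gamma_{z1}$ with $|\Gamma_{z0}|=|\Gamma_{z1}|=\frac12|\Gamma_z|$ (e.g. $\Gamma=[0,1)$ with dyadic intervals). For $x\in\Gamma$, $x_{1:i}$ is the unique string of length $i$ with $x\in\Gamma_{x_{1:i}}$. Write $l=\ell(z)$ for the length of $z$. Models. All distributions $q$ on $\Gamma$ considered (including the true one $\dot q$) have density constant on each cell $\Gamma_{x'}$, $\ell(x')=m$. Such a $q$ is parametrized by branching probabilities $q_{z0}=P[\Gamma_{z0}|\Gamma_z,q]$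 and $q_{z1}=P[\Gamma_{z1}|\Gamma_z,q]$, with $q_{z0}+q_{z1}=1$. Let $\vec q_{z*}:=(q_{zy}:y\in\mathbb B_1^{m-l})$. The branching probabilities of $\dot q$ are denoted $\dot q_{z0},\dot q_{z1}$. Prior. Fix parameters $\alpha>0$ and $u,s\in[0,1]$ with $u+s=1$. The prior $p_z(\vec q_{z*})$ (a probability measure, written as a generalized density with Dirac deltas) is defined recursively: $p_z(\vec q_{z*})=1$ if $\ell(z)=m$ (empty collection), and for $\ell(z)<m$ $$p_z(\vec q_{z*})=u\prod_{y\in\mathbb B_1^{m-l}}\delta(q_{zy}-\tfrac12)+s\cdot\mathrm{Beta}(q_{z0},q_{z1}|\alpha,\alpha)\,p_{z0}(\vec q_{z0*})\,p_{z1}(\vec q_{z1*}),$$ where $\mathrm{Beta}(p,q|a,b)=\frac{\Gamma(a+b)}{\Gamma(a)\Gamma(b)}p^{a-1}q^{b-1}\delta(p+q-1)$ and $\Gamma(\cdot)$ with a real argument is the Gamma function. Likelihood, evidence, posterior. The data is $D=(x^1,\dots,x^n)$; $D_z$ is the sublist (with multiplicity) of points of $D$ lying in $\Gamma_z$, and $n_z:=|D_z|$. For $x\in\Gamma_z$, $p_z(x|q):=\prod_{i=l+1}^m 2q_{x_{1:i}}$ (empty product $=1$), and $p_z(D_z|\vec q_{z*}):=\prod_{x\in D_z}p_z(x|q)$. The evidence is $p_z(D_z):=\int p_z(D_z|\vec q_{z*})\,p_z(\vec q_{z*})\,d\vec q_{z*}$ and the posterior is $p_z(\vec q_{z*}|D_z):=p_z(D_z|\vec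 q_{z*})\,p_z(\vec q_{z*})/p_z(D_z)$. For $l=m$ both sides of the claim are densities over the empty space, equal to $1$ by convention.
   Formalization: Added: every cell Γ_{zy} with ℓ(zy)<m has positive mass under the true distribution (else true branching values are undefined and the claim fails), and if s=0 all true branching probabilities below z equal 1/2 (else the posterior stays at 1/2). *)

(* Defs.v *)
From HB Require Import structures.
From mathcomp Require Import all_boot all_order all_algebra.
From mathcomp Require Import all_classical all_reals all_analysis.

Set Implicit Arguments.
Unset Strict Implicit.
Unset Printing Implicit Defensive.

Import Order.TTheory GRing.Theory Num.Theory.
Import numFieldNormedType.Exports.

Local Open Scope classical_set_scope.
Local Open Scope ring_scope.
Local Open Scope ereal_scope.

(* Only the cells of depth at most m are constrained. *)
Record tree_partition (R : realType) d (Gam : measurableType d)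
    (vol : probability Gam R) (m : nat) (cell : seq bool -> set Gam) : Prop := {
  cell_measurable : forall z, (size z <= m)%N -> measurable (cell z) ;
  cell_nil : cell [::] = setT ;
  cell_split : forall z, (size z < m)%N ->
    cell z = cell (rcons z false) `|` cell (rcons z true) ;
  cell_disjoint : forall z, (size z < m)%N ->
    cell (rcons z false) `&` cell (rcons z true) = set0 ;
  cell_half : forall z b, (size z < m)%N ->
    vol (cell (rcons z b)) = (2^-1)%:E * vol (cell z) }.

Definition cellwise_constant_density (R : realType) d (Gam : measurableType d)
    (vol : probability Gam R) (m : nat) (cell : seq bool -> set Gam)
    (q : probability Gam R) : Prop :=
  exists f : Gam -> R,
    [/\ measurable_fun setT f, forall x, (0 <= f x)%R,
        forall w, size w = m ->
          forall x y, cell w x -> cell w y -> f x = f y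
      & forall A, measurable A -> q A = \int[vol]_(x in A) (f x)%:E].

Definition cond_prob (R : realType) d (T : measurableType d)
    (q : probability T R) (A B : set T) : R :=
  (fine (q (A `&` B)) / fine (q B))%R.

(* For nonempty w, take (size w).-1 w is the parent of w; the value is the
   conditional probability only when the parent cell has positive mass. *)
Definition branching (R : realType) d (T : measurableType d)
    (cell : seq bool -> set T) (q : probability T R) (w : seq bool) : R :=
  cond_prob q (cell w) (cell (take (size w).-1 w)).

(* The string x_{1:i}; it is unique when i <= m and cell is a tree partition. *)
Definition prefix_of (T : Type) (cell : seq bool -> set T) (i : nat) (x : T) :
  seq bool := xget [::] [set w | size w = i /\ cell w x].

(* The index set B_1^h, with h = m - l. *)
Definition strings (h : nat) := {y : seq bool | (0 < size y <= h)%N}.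

Definition qvec (R : realType) (h : nat) := {ptws (strings h) -> R}.
HB.instance Definition _ (R : realType) (h : nat) :=
  Uniform.copy (qvec R h) {ptws (strings h) -> R}.
HB.instance Definition _ (R : realType) (h : nat) :=
  Pointed.copy (qvec R h) {ptws (strings h) -> R}.

Definition borel (T : ptopologicalType) := g_sigma_algebraType (@open T).

Definition coord (R : realType) (h : nat) (v : qvec R h) (y : seq bool) : R :=
  oapp v 0%R (insub y).

(* The vector q_{z*} assembled from q_{z0} = x, q_{z1} = 1 - x, q_{z0*} = v0
   and q_{z1*} = v1. *)
Definition graft (R : realType) (h : nat) (t : R * borel (qvec R h) * borel (qvec R h)) :
    borel (qvec R h.+1) := fun y =>
  let: (x, v0, v1) := t in
  match val y with
  | [:: b] => if b then (1 - x)%R else x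
  | b :: y' => coord (if b then v1 else v0) y'
  | [::] => 0%R
  end.

Definition Gamma (R : realType) (a : R) : R :=
  fine (\int[lebesgue_measure]_(t in `]0%R, +oo[)
    (t `^ (a - 1) * expR (- t))%:E).

Definition beta_density (R : realType) (a b p q : R) : R :=
  (Gamma (a + b) / (Gamma a * Gamma b) * p `^ (a - 1) * q `^ (b - 1))%R.

(* The first marginal of Beta(p, q | a, b) on {p + q = 1}: the factor
   delta(p + q - 1) is realised by q = 1 - p, here and in graft. *)
Definition beta_law (R : realType) (a b : R) (A : set R) : \bar R :=
  \int[lebesgue_measure]_(p in A `&` `]0%R, 1%R[)
    (beta_density a b p (1 - p))%:E.

(* The prior p_z depends on z only through the height h = m - l of the subtree
   rooted at z. It is a plain set function assembled from measures; for
   alpha > 0, u, s >= 0 and u + s = 1 it is a probability measure. *)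
Fixpoint prior_at (R : realType) (alpha u s : R) (h : nat) :
    set (borel (qvec R h)) -> \bar R :=
  match h return set (borel (qvec R h)) -> \bar R with
  | 0%N => fun A => \d_((fun=> 2^-1%R) : borel (qvec R 0)) A
  | h'.+1 => fun A =>
      u%:E * \d_((fun=> 2^-1%R) : borel (qvec R h'.+1)) A +
      s%:E * pushforward
        ((beta_law alpha alpha \x @prior_at R alpha u s h')
          \x @prior_at R alpha u s h')
        (@graft R h') A
  end.
Arguments prior_at {R} alpha u s h A.

Section bayes.
Context (R : realType) d (Gam : measurableType d).
Variables (m : nat) (cell : seq bool -> set Gam) (alpha u s : R).
Implicit Types (z : seq bool) (D : seq Gam).

Definition prior z : set (borel (qvec R (m - size z))) -> \bar R :=
  prior_at alpha u s (m - size z).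
Arguments prior z A : clear implicits.

Definition restrict_data z D : seq Gam := [seq x <- D | x \in cell z].

Definition point_likelihood z (v : qvec R (m - size z)) (x : Gam) : R :=
  (\prod_((size z).+1 <= i < m.+1)
     (2 * coord v (drop (size z) (prefix_of cell i x))))%R.

Definition likelihood z D (v : qvec R (m - size z)) : R :=
  (\prod_(x <- restrict_data z D) point_likelihood v x)%R.

Definition evidence z D : \bar R :=
  \int[prior z]_v (likelihood D v)%:E.

Definition posterior z D : set (borel (qvec R (m - size z))) -> \bar R :=
  fun A => (\int[prior z]_(v in A) (likelihood D v)%:E)
           * ((fine (evidence z D))^-1)%:E.
Arguments posterior z D A : clear implicits.

Definition true_vec (q : probability Gam R) z : borel (qvec R (m - size z)) :=
  fun y => branching cell q (z ++ val y).

End bayes.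
Arguments posterior {R d Gam} m cell alpha u s z D A.
Arguments true_vec {R d Gam} m cell q z.

Definition cvg_weakly (R : realType) (T : ptopologicalType)
    (mu_ : nat -> set (borel T) -> \bar R) (mu : set (borel T) -> \bar R) :
    Prop :=
  forall f : T -> R, continuous f -> (exists M : R, forall x, (`|f x| <= M)%R) ->
    \int[mu_ n]_x (f x)%:E @[n --> \oo] --> \int[mu]_x (f x)%:E.

Definition mutually_independent (R : realType) d d' (Om : measurableType d)
    (T : measurableType d') (P : probability Om R)
    (X : nat -> {RV P >-> T}) : Prop :=
  forall (n : nat) (A : nat -> set T), (forall i, measurable (A i)) ->
    P (\bigcap_(i < n) (X i @^-1` A i)) = \prod_(i < n) P (X i @^-1` A i).

Definition iid_from (R : realType) d d' (Om : measurableType d)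
    (T : measurableType d') (P : probability Om R)
    (X : nat -> {RV P >-> T}) (q : probability T R) : Prop :=
  (forall i A, measurable A -> distribution P (X i) A = q A) /\
  mutually_independent X.

Definition sample (R : realType) d d' (Om : measurableType d)
    (T : measurableType d') (P : probability Om R)
    (X : nat -> {RV P >-> T}) (n : nat) (om : Om) : seq T :=
  [seq X i om | i <- iota 0 n].

(* Main.v *)
(* A direct Schwartz-type argument, without Beta conjugacy. Let [L v] be the
   likelihood of the vector [v], [t] the true vector, [Q y] the true mass of the
   cell of [z ++ y], [N y] the number of data points in it and [h = m - l].
   - Almost surely [N w / n --> Q w] for every string [w], and cells of mass 0
     contain no data.
   - If [v_w >= c * t_w] for all [w], then [L v >= (c ^ h) ^ n * L t]; the prior
     gives positive mass to such vectors for every [c < 1], which bounds the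
     evidence from below.
   - [x <= exp (x - 1)] at [x = sqrt (v_w / t_w)] gives
     [L v <= L t * exp (2 * sum_w N w * (sqrt (v_w / t_w) - 1))]; with [N w]
     replaced by [n * Q w] the exponent is [- n] times a positive combination of
     the squared Hellinger distances between the splits of [v] and of [t].
   Hence [L v / L t] is eventually at most [exp (- n * k)] uniformly away from
   [t], for some [k > 0], and choosing [c] with [c ^ h > exp (- k)] the posterior
   mass away from [t] tends to 0. The constants of the prior only need to be
   finite and positive. *)
Require Import Defs.
From HB Require Import structures.
From mathcomp Require Import all_boot all_order all_algebra.
From mathcomp Require Import all_classical all_reals all_analysis.
From mathcomp Require Import unstable measurable_realfun ring lra.

Set Implicit Arguments.
Unset Strict Implicit.
Unset Printing Implicit Defensive.

Import Order.TTheory GRing.Theory Num.Theory.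
Import numFieldNormedType.Exports.

Local Open Scope classical_set_scope.
Local Open Scope ring_scope.

(** * Finiteness and positivity of the Gamma and Beta integrals *)

(** Square roots take the place of logarithms because [sqrt (v_w / t_w) - 1] lies between [-1] and a
    constant depending on [t] only. Replacing frequencies by their limits therefore costs an error
    uniform in [v], whereas [ln (v_w / t_w)] has no lower bound near [v_w = 0]. The condition
    [v_w >= c * t_w] is multiplicative so that it acts on the likelihood of every data list at once,
    and it keeps its meaning where [t_w = 0]. Two obstacles come from the encoding. The prior and
    the posterior are bare set functions, so finite measures agreeing with them on measurable sets
    are produced before any measure theory applies. And the vectors range over a full product space,
    where a likelihood can be negative; integrals are therefore moved to the vectors whose siblings
    are nonnegative and sum to 1, which carry the whole prior. The law of large numbers rests on
    second moments: Chebyshev and Borel-Cantelli along the squares, and monotonicity of the counts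
    in between. *)

Lemma le_integral_powR01 (R : realType) (a : R) : 0 < a ->
  (\int[lebesgue_measure]_(x in `]0%R, 1%R]) (x `^ (a - 1))%:E <= (a^-1)%:E)%E.
Proof.
move=> a0.
(* The integrand may blow up at 0, so the primitive [x ^ a / a] is used on compact intervals
   increasing to []0, 1]]. Starting at [i.+2] keeps them nondegenerate. *)
pose F (i : nat) : set R := [set` `[i.+2%:R^-1, 1%R]].
have FE : `]0%R, 1%R]%classic = \bigcup_i F i.
  apply/seteqP; split => [x|x [i _]]; rewrite /F/= !in_itv/=.
    move=> /andP[x0 x1].
    exists (Num.truncn x^-1) => //; rewrite /= in_itv/= x1 andbT.
    rewrite -(invrK x) lef_pV2 ?posrE ?invr_gt0// invrK.
    have := truncnS_gt x^-1 => /ltW /le_trans; apply.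
    by rewrite ler_nat.
  by move=> /andP[xi x1]; rewrite x1 andbT (lt_le_trans _ xi)// invr_gt0.
have ndF : nondecreasing_seq F.
  move=> i j ij; apply/subsetPset => x; rewrite /F/= !in_itv/= => /andP[xi ->].
  by rewrite andbT (le_trans _ xi)// lef_pV2 ?posrE// ler_nat !ltnS.
have mf (D : set R) : measurable_fun D (EFin \o (@powR R ^~ (a - 1))).
  apply/measurable_EFinP; exact: measurable_funTS (measurable_powR _).
have Fle i : (\int[lebesgue_measure]_(x in F i) (x `^ (a - 1))%:E <= (a^-1)%:E)%E.
  have i1 : i.+2%:R^-1 < 1 :> R by rewrite invf_lt1// ltr1n.
  have i0 : 0 < i.+2%:R^-1 :> R by rewrite invr_gt0.
  have pos (x : R) : i.+2%:R^-1 <= x -> x \in `]0, +oo[ :> bool.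
    by move=> ix; rewrite in_itv/= andbT; exact: lt_le_trans ix.
  have cont b : {within `[(i.+2%:R^-1 : R), 1], continuous (fun x : R => x `^ b)}.
    apply: derivable_within_continuous => x; rewrite in_itv/= => /andP[ix _].
    exact/derivable_powR/pos.
  rewrite (@continuous_FTC2 _ _ (fun x => a^-1 * x `^ a))//.
  - rewrite powR1 mulr1 -EFinB lee_fin lerBlDr lerDl mulr_ge0// ?powR_ge0//.
    by rewrite invr_ge0 ltW.
  - have cc (x : R) : i.+2%:R^-1 <= x -> (a^-1 * (y : R) `^ a) @[y --> x] --> a^-1 * x `^ a.
      move=> ix; apply: cvgM; first exact: cvg_cst.
      apply: (@differentiable_continuous _ _ _ x (fun y : R => y `^ a)).
      exact/derivable1_diffP/derivable_powR/pos.
    split.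
    + move=> x; rewrite in_itv/= => /andP[/ltW ix _].
      by apply: derivableM => //; exact/derivable_powR/pos.
    + exact/cvg_at_right_filter/cc.
    + exact/cvg_at_left_filter/cc/ltW.
  - move=> x; rewrite in_itv/= => /andP[/ltW ix _].
    rewrite derive1E deriveMl; last exact/derivable_powR/pos.
    by rewrite -derive1E powR_derive1 ?pos// /GRing.scale/= mulrA mulVf ?mul1r// gt_eqF.
have f0 i (x : R) : F i x -> (0 <= (x `^ (a - 1))%:E)%E.
  by rewrite lee_fin powR_ge0.
have mF i : measurable (F i) by exact: measurable_itv.
have := @ge0_nondecreasing_set_cvg_integral _ (measurableTypeR R) R F
  (EFin \o (@powR R ^~ (a - 1))) lebesgue_measure ndF mF (fun i => mf _) f0.
rewrite FE => /cvg_lim <-//; apply: lime_le; last exact: nearW.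
apply: ereal_nondecreasing_is_cvgn.
exact: (@ge0_nondecreasing_set_nondecreasing_integral _ (measurableTypeR R) R F
  (EFin \o (@powR R ^~ (a - 1))) lebesgue_measure ndF mF (fun i => mf _) f0).
Qed.

(** Lebesgue measure is determined by the intervals []a, b]], and the reflection pulls such an
    interval back to [[1 - b, 1 - a[], of the same length. This transfers the integral bound at the
    endpoint 0 to the endpoint 1. *)
Lemma lebesgue_measure_onem (R : realType) (A : set R) : measurable A ->
  pushforward lebesgue_measure (@onem R : _ -> measurableTypeR R) A =
  lebesgue_measure A.
Proof.
move=> mA; apply/esym/lebesgue_measure_unique => //=.
  by apply: measurable_funB => //; exact: measurable_cst.
move=> _ _ [[a b]] _ <-; rewrite /pushforward.
have -> : onem @^-1` [set` `]a, b]] = [set` `[b.~, a.~[].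
  by apply/seteqP; split => x; rewrite /onem /= !in_itv/= => /andP[? ?];
    apply/andP; split; lra.
rewrite !lebesgue_measure_itv/= !lte_fin /onem ltrD2l ltrN2.
by case: ifP => // _; rewrite -!EFinB; congr (_%:E); lra.
Qed.

(** Here [q ^ (a - 1) = q ^ a / q] has numerator at most 1 and denominator at least 1/2, so no case
    distinction on [a < 1] arises. *)
Lemma le_powRB1 (R : realType) (a q : R) : 0 < a -> 2^-1 <= q -> q <= 1 ->
  q `^ (a - 1) <= 2.
Proof.
move=> a0 q1 q2; have q0 : 0 < q by apply: lt_le_trans q1; rewrite invr_gt0.
rewrite -(ler_pM2l q0) mulr_powRB1 ?(ltW q0)//.
apply: (@le_trans _ _ 1); last by lra.
by rewrite -(powRr0 q); apply: ger_powR; rewrite ?q0 ?q2 ?(ltW a0).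
Qed.

Lemma ge_powRB1 (R : realType) (a e q : R) : 0 < a -> 0 < e -> e <= q -> q <= 1 ->
  e `^ a <= q `^ (a - 1).
Proof.
move=> a0 e0 eq q1; have q0 : 0 < q by exact: lt_le_trans eq.
apply: (@le_trans _ _ (q `^ a)).
  by apply: ge0_ler_powR; rewrite ?nnegrE //; exact: ltW.
by apply: ger_powR; rewrite ?q0//; lra.
Qed.

(** One of [p] and [1 - p] is at least 1/2 and its factor is at most 2. The product is thus
    controlled by the two endpoint singularities separately, each integrable on its own. *)
Lemma beta_kernel_le (R : realType) (a p : R) : 0 < a -> 0 < p < 1 ->
  p `^ (a - 1) * (1 - p) `^ (a - 1) <= 2 * (p `^ (a - 1) + (1 - p) `^ (a - 1)).
Proof.
move=> a0 /andP[p0 p1].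
have [h|h] := leP p 2^-1.
  have := @le_powRB1 R a (1 - p) a0; have := powR_ge0 p (a - 1).
  have := powR_ge0 (1 - p) (a - 1).
  by move=> ? ? /(_ ltac:(lra) ltac:(lra)) ?; nra.
have := @le_powRB1 R a p a0; have := powR_ge0 p (a - 1).
have := powR_ge0 (1 - p) (a - 1).
by move=> ? ? /(_ ltac:(lra) ltac:(lra)) ?; nra.
Qed.

Lemma integral_beta_kernel_lty (R : realType) (a : R) : 0 < a ->
  (\int[lebesgue_measure]_(p in `]0%R, 1%R[)
     (p `^ (a - 1) * (1 - p) `^ (a - 1))%:E < +oo)%E.
Proof.
move=> a0.
have mp' (D : set R) : measurable_fun D (@powR R ^~ (a - 1)).
  exact: measurable_funTS (measurable_powR _).
have mp (D : set R) : measurable_fun D (EFin \o (@powR R ^~ (a - 1))).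
  exact/measurable_EFinP.
have mo : measurable_fun setT (@onem R).
  by apply: measurable_funB => //; exact: measurable_cst.
have mq' (D : set R) : measurable_fun D (fun p : R => (1 - p) `^ (a - 1)).
  by apply: measurable_funTS; exact: measurableT_comp (measurable_powR _) mo.
have mq (D : set R) : measurable_fun D (EFin \o (fun p : R => (1 - p) `^ (a - 1))).
  exact/measurable_EFinP.
have I1 : (\int[lebesgue_measure]_(p in `]0%R, 1%R[) (p `^ (a - 1))%:E <= (a^-1)%:E)%E.
  apply: le_trans (le_integral_powR01 a0).
  apply: (@ge0_subset_integral _ (measurableTypeR R)) => //; first exact: (mp).
    by move=> *; rewrite lee_fin powR_ge0.
  by move=> x; rewrite /= !in_itv/= => /andP[-> /ltW].
have I2 : (\int[lebesgue_measure]_(p in `]0%R, 1%R[) ((1 - p) `^ (a - 1))%:E <= (a^-1)%:E)%E.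
  apply: le_trans I1.
  rewrite (_ : `]0%R, 1%R[%classic =
      (@onem R : _ -> measurableTypeR R) @^-1` `]0%R, 1%R[); last first.
    by apply/seteqP; split => x; rewrite /onem /= !in_itv/= => /andP[? ?];
      apply/andP; split; lra.
  have /= <- := @ge0_integral_pushforward _ _ (measurableTypeR R)
    (measurableTypeR R) R (@onem R) mo lebesgue_measure `]0%R, 1%R[%classic
    (fun p => (p `^ (a - 1))%:E).
  - have -> : (@onem R : _ -> measurableTypeR R) @^-1` `]0%R, 1%R[ = `]0%R, 1%R[%classic.
      by apply/seteqP; split => x; rewrite /onem /= !in_itv/= => /andP[? ?];
        apply/andP; split; lra.
    rewrite le_eqVlt; apply/orP; left; apply/eqP.
    by apply: eq_measure_integral => A mA _; exact: lebesgue_measure_onem.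
  - by [].
  - exact: mp.
  - by move=> *; rewrite lee_fin powR_ge0.
apply: (@le_lt_trans _ _ (\int[lebesgue_measure]_(p in `]0%R, 1%R[)
   (2%:E * ((p `^ (a - 1))%:E + ((1 - p) `^ (a - 1))%:E)))%E).
  apply: (@ge0_le_integral _ (measurableTypeR R)) => //.
  - by move=> *; rewrite lee_fin mulr_ge0// powR_ge0.
  - apply/measurable_EFinP; apply: measurable_funM.
      exact: mp'.
    exact: mq'.
  - apply: emeasurable_funM; first exact: measurable_cst.
    by apply: emeasurable_funD; [exact: mp|exact: mq].
  - move=> p; rewrite /= in_itv/= -EFinD -EFinM lee_fin; exact: beta_kernel_le.
rewrite ge0_integralZl//; first last.
- by move=> *; rewrite -EFinD lee_fin addr_ge0// powR_ge0.
- by apply: emeasurable_funD; [exact: mp|exact: mq].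
rewrite lte_mul_pinfty// ge0_integralD//; first last.
- exact: mq.
- by move=> *; rewrite lee_fin powR_ge0.
- exact: mp.
- by move=> *; rewrite lee_fin powR_ge0.
by apply: lte_add_pinfty; [apply: le_lt_trans I1 _|apply: le_lt_trans I2 _]; exact: ltry.
Qed.

Section finite_measure_of.
Context d (T : measurableType d) (R : realType) (m : set T -> \bar R).
Hypotheses (m0 : m set0 = 0%E) (m_ge0 : forall A, (0 <= m A)%E).
Hypotheses (m_add : semi_sigma_additive m) (mT : (m setT < +oo)%E).

(* A constant to which the measure instances of [m] can be attached. *)
Definition raw_measure := m.

HB.instance Definition _ := isMeasure.Build _ _ _ raw_measure m0 m_ge0 m_add.

Let fin_raw_measure : fin_num_fun raw_measure.
Proof.
move=> A mA; rewrite ge0_fin_numE; last exact: m_ge0.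
apply: le_lt_trans mT; rewrite -/raw_measure -[X in (_ <= X)%E]/(raw_measure setT).
by apply: le_measure; rewrite ?inE.
Qed.

HB.instance Definition _ := Measure_isFinite.Build _ _ _ raw_measure fin_raw_measure.

(** The equation is between functions on all sets, so rewriting with it replaces a bare set function
    by a measure inside integrals and products. *)
Lemma finite_measure_of :
  exists nu : {finite_measure set T -> \bar R}, (nu : set T -> \bar R) = m.
Proof. by exists raw_measure. Qed.

End finite_measure_of.

Lemma density_sigma_additive d (T : measurableType d) (R : realType)
    (mu : {measure set T -> \bar R}) (f : T -> \bar R) :
  measurable_fun setT f -> (forall x, 0 <= f x)%E ->
  semi_sigma_additive (fun A => \int[mu]_(x in A) f x)%E.
Proof.
move=> mf f0 F mF tF mUF; rewrite ge0_integral_bigcup//; last exact: measurable_funTS.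
by apply: is_cvg_ereal_nneg_natsum_cond => n _ _; exact: integral_ge0.
Qed.

Lemma density_finite_measure d (T : measurableType d) (R : realType)
    (mu : {measure set T -> \bar R}) (f : T -> \bar R) :
  measurable_fun setT f -> (forall x, 0 <= f x)%E ->
  (\int[mu]_x f x < +oo)%E ->
  exists nu : {finite_measure set T -> \bar R},
    (nu : set T -> \bar R) = (fun A => \int[mu]_(x in A) f x)%E.
Proof.
move=> mf f0 foo; apply: finite_measure_of => //.
- by rewrite integral_set0.
- by move=> A; exact: integral_ge0.
- exact: density_sigma_additive.
Qed.

(** With [c = 2 * (k + 1)], the inequality [t / c <= exp (t / c)] raised to the power [k + 1] gives
    [t ^ (k + 1) <= c ^ (k + 1) * exp (t / 2)]. The right-hand side is arranged as a constant times
    the exponential density of rate 1/2, whose integral is known. *)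
Lemma le_powRB1_expR (R : realType) (a : R) (k : nat) (t : R) :
  a <= k.+1%:R -> 1 <= t ->
  t `^ (a - 1) * expR (- t) <=
  2 * (k.+1%:R *+ 2) ^+ k.+1 * (2^-1 * expR (- 2^-1 * t)).
Proof.
move=> ak t1; have t0 : 0 < t by exact: lt_le_trans t1.
set c : R := k.+1%:R *+ 2.
have c0 : 0 < c by rewrite /c pmulrn_rgt0.
have h1 : t `^ (a - 1) <= t ^+ k.+1.
  rewrite -powR_mulrn ?(ltW t0)//; apply: ler_powR => //.
  by apply: le_trans ak; lra.
have h2 : t ^+ k.+1 <= c ^+ k.+1 * expR (2^-1 * t).
  have -> : 2^-1 * t = (t / c) * k.+1%:R.
    rewrite /c -mulr_natr; field.
    by rewrite nat1r pnatr_eq0.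
  rewrite expRM_natr -exprMn lerXn2r ?nnegrE ?(ltW t0)//.
    by rewrite mulr_ge0 ?(ltW c0)// expR_ge0.
  rewrite -ler_pdivrMl// mulrC; apply: le_trans (expR_ge1Dx _).
  by rewrite lerDr.
have e : expR (- t) = expR (- 2^-1 * t) * expR (- 2^-1 * t).
  by rewrite -expRD; congr expR; lra.
have e1 : expR (2^-1 * t) * expR (- 2^-1 * t) = 1.
  by rewrite -expRD mulNr subrr expR0.
rewrite e.
have e0 := expR_gt0 (- 2^-1 * t).
apply: (@le_trans _ _ (c ^+ k.+1 * expR (2^-1 * t) * (expR (- 2^-1 * t) * expR (- 2^-1 * t)))).
  by rewrite ler_wpM2r ?mulr_ge0 ?(ltW e0)// (le_trans h1).
rewrite le_eqVlt; apply/orP; left; apply/eqP.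
transitivity (c ^+ k.+1 * (expR (2^-1 * t) * expR (- 2^-1 * t)) * expR (- 2^-1 * t)).
  by ring.
by rewrite e1; field.
Qed.

Lemma measurable_Gamma_integrand (R : realType) (a : R) (D : set R) :
  measurable_fun D (fun t : R => t `^ (a - 1) * expR (- t)).
Proof.
apply: measurable_funTS; apply: measurable_funM; first exact: measurable_powR.
by apply: measurableT_comp; [exact: measurable_expR|exact: oppr_measurable].
Qed.

(** [fine] sends an infinite integral to 0, so positivity includes finiteness: [t ^ (a - 1)]
    dominates on []0, 1]], an exponential density on the tail. *)
Lemma Gamma_gt0 (R : realType) (a : R) : 0 < a -> 0 < Gamma a.
Proof.
move=> a0; rewrite /Gamma; set f := fun t : R => t `^ (a - 1) * expR (- t).
have f0 t : 0 <= f t by rewrite mulr_ge0 ?powR_ge0 ?expR_ge0.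
have mf (D : set R) : measurable_fun D (EFin \o f).
  by apply/measurable_EFinP; exact: measurable_Gamma_integrand.
pose k := Num.truncn a; pose C : R := 2 * (k.+1%:R *+ 2) ^+ k.+1.
have C0 : 0 <= C by rewrite /C mulr_ge0// exprn_ge0// mulrn_wge0.
apply: fine_gt0; apply/andP; split.
  (* On [[1, 2]] one has [t ^ (a - 1) = t ^ a / t >= 1/2] and [exp (- t) >= exp (- 2)]. *)
  apply: (@lt_le_trans _ _ (\int[lebesgue_measure]_(t in `[1%R, 2%R]) (2^-1 * expR (- 2%:R))%:E)%E).
    rewrite integral_cst//= lebesgue_measure_itv/= lte_fin ltr1n -EFinB -EFinM lte_fin.
    by rewrite mulr_gt0 ?mulr_gt0 ?expR_gt0 ?invr_gt0//; lra.
  apply: (@le_trans _ _ (\int[lebesgue_measure]_(t in `[1%R, 2%R]) (f t)%:E)%E).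
    apply: (@ge0_le_integral _ (measurableTypeR R)) => //.
    - exact: mf.
    - move=> t; rewrite /= in_itv/= => /andP[t1 t2]; rewrite lee_fin /f.
      apply: ler_pM; rewrite ?expR_ge0//; last by rewrite ler_expR lerN2.
      have t0 : 0 < t by exact: lt_le_trans t1.
      have h : 1 <= t `^ a by rewrite -(powRr0 t); apply: ler_powR => //; exact: ltW.
      rewrite -(ler_pM2l t0) mulr_powRB1 ?(ltW t0)//; lra.
  apply: (@ge0_subset_integral _ (measurableTypeR R)) => //; first exact: mf.
    by move=> *; rewrite lee_fin.
  by move=> t; rewrite /= !in_itv/= => /andP[t1 _]; rewrite (lt_le_trans _ t1).
rewrite (_ : `]0%R, +oo[%classic = `]0%R, 1%R] `|` `]1%R, +oo[); last first.
  apply/seteqP; split => t; rewrite /= !in_itv/= ?andbT.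
    by move=> ->; case: (leP t 1); [left|right].
  by case=> [/andP[]//|]; apply: lt_trans.
rewrite (@ge0_integral_setU _ (measurableTypeR R))//; first last.
- apply/disj_setPRL => t; rewrite /= !in_itv/= andbT => t1 /andP[_].
  by rewrite leNgt t1.
- by move=> *; rewrite lee_fin; exact: f0.
- exact: mf.
apply: lte_add_pinfty.
  apply: le_lt_trans (ltry (a^-1)); apply: le_trans (le_integral_powR01 a0).
  apply: (@ge0_le_integral _ (measurableTypeR R)) => //.
  - by move=> *; rewrite lee_fin; exact: f0.
  - exact: mf.
  - by apply/measurable_EFinP; exact: measurable_funTS (measurable_powR _).
  - move=> t; rewrite /= in_itv/= => /andP[t1 t2]; rewrite lee_fin /f.
    by rewrite ler_piMr ?powR_ge0// -expR0 ler_expR oppr_le0 ltW.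
have mpdf : measurable_fun setT (exponential_pdf (2^-1 : R)).
  exact: measurable_exponential_pdf.
have pdf0 (t : R) : 0 <= exponential_pdf 2^-1 t by apply: exponential_pdf_ge0; lra.
apply: (@le_lt_trans _ _ (\int[lebesgue_measure]_(t in `]1%R, +oo[) (C%:E * (exponential_pdf 2^-1 t)%:E))%E).
  apply: (@ge0_le_integral _ (measurableTypeR R)) => //.
  - by move=> *; rewrite lee_fin; exact: f0.
  - exact: mf.
  - apply: emeasurable_funM; first exact: measurable_cst.
    by apply/measurable_EFinP; exact: measurable_funTS.
  - move=> t; rewrite /= in_itv/= andbT => t1; rewrite -EFinM lee_fin /f.
    rewrite exponential_pdfE; last by apply: ltW; exact: lt_trans t1.
    apply: le_powRB1_expR; last exact: ltW.
    exact/ltW/truncnS_gt.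
rewrite ge0_integralZl//; last 2 first.
- by apply/measurable_EFinP; exact: measurable_funTS.
- by move=> t _; rewrite lee_fin.
rewrite lte_mul_pinfty//; apply: (@le_lt_trans _ _ 1%E); last exact: ltry.
rewrite -(@integral_exponential_pdf R 2^-1); last by lra.
apply: (@ge0_subset_integral _ (measurableTypeR R)) => //.
- exact/measurable_EFinP.
- by move=> t _; rewrite lee_fin.
Qed.

Section beta_law.
Context (R : realType) (a : R).
Hypothesis a0 : 0 < a.

Let f (p : R) : R := beta_density a a p (1 - p).

Let K : R := Gamma (a + a) / (Gamma a * Gamma a).

Let K_gt0 : 0 < K.
Proof. by rewrite divr_gt0 ?mulr_gt0 ?Gamma_gt0 ?addr_gt0. Qed.

Let fE p : f p = K * (p `^ (a - 1) * (1 - p) `^ (a - 1)).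
Proof. by rewrite /f /beta_density mulrA. Qed.

Let f_ge0 p : 0 <= f p.
Proof.
rewrite fE; apply: mulr_ge0; first exact: ltW.
by apply: mulr_ge0; exact: powR_ge0.
Qed.

Let mkern (D : set R) :
  measurable_fun D (fun p : R => p `^ (a - 1) * (1 - p) `^ (a - 1)).
Proof.
apply: measurable_funTS; apply: measurable_funM; first exact: measurable_powR.
have mo : measurable_fun setT (fun p : R => 1 - p).
  by apply: measurable_funB => //; exact: measurable_cst.
exact: measurableT_comp (measurable_powR _) mo.
Qed.

Let mf' (D : set R) : measurable_fun D f.
Proof.
rewrite (_ : f = fun p => K * (p `^ (a - 1) * (1 - p) `^ (a - 1))).
  by apply: measurable_funM; [exact: measurable_cst|exact: mkern].
by apply/funext => p; exact: fE.
Qed.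

Let mf (D : set R) : measurable_fun D (EFin \o f).
Proof. by apply/measurable_EFinP; exact: mf'. Qed.

(** The restriction to the open unit interval is moved from the domain of integration into the
    density. *)
Lemma beta_law_finite_measure :
  exists nu : {finite_measure set R -> \bar R}, (nu : set R -> \bar R) = beta_law a a.
Proof.
have [| | |nu nuE] := @density_finite_measure _ (measurableTypeR R) R
  lebesgue_measure (((EFin \o f) \_ `]0%R, 1%R[) : R -> \bar R).
- rewrite restrict_EFin; apply/measurable_EFinP/measurable_restrict => //.
  exact: mf'.
- by move=> p; apply: erestrict_ge0 => ? _; rewrite lee_fin.
- rewrite -integral_mkcond /=.
  under eq_integral do rewrite fE EFinM.
  rewrite ge0_integralZl//; last 3 first.
  + by apply/measurable_EFinP; exact: mkern.
  + by move=> p _; rewrite lee_fin mulr_ge0 ?powR_ge0.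
  + by rewrite lee_fin ltW.
  by rewrite lte_mul_pinfty ?lee_fin ?(ltW K_gt0)//; exact: integral_beta_kernel_lty.
have <- : (nu : set R -> \bar R) = beta_law a a.
  by rewrite nuE; apply/funext => A; rewrite /beta_law integral_mkcondr.
apply: finite_measure_of.
- exact: measure0.
- by move=> A; exact: measure_ge0.
- exact: (@measure_semi_sigma_additive _ _ _ nu).
- by rewrite -ge0_fin_numE//; exact: (@fin_num_measure _ _ _ nu).
Qed.

Lemma beta_law_unit_itv : beta_law a a `]0, 1[ = beta_law a a setT.
Proof. by rewrite /beta_law setIid setTI. Qed.

Lemma beta_law_itv_gt0 (c e : R) : 0 <= c -> 0 < e -> c + e <= 1 ->
  (0 < beta_law a a `[c, (c + e)%R])%E.
Proof.
move=> c0 e0 ce1; rewrite /beta_law.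
(* The density may vanish or blow up at 0 and 1. On this smaller interval both [p] and [1 - p] are
   at least [e / 4], which bounds each factor below by [(e / 4) ^ a]. *)
pose I : interval R := `[c + e / 4, c + e / 4 *+ 2].
pose k : R := K * ((e / 4) `^ a * (e / 4) `^ a).
have e4 : 0 < e / 4 by lra.
have k0 : 0 < k by apply: mulr_gt0 => //; apply: mulr_gt0; exact: powR_gt0.
apply: (@lt_le_trans _ _ (\int[lebesgue_measure]_(t in [set` I]) k%:E)%E).
  rewrite integral_cst//= lebesgue_measure_itv/= lte_fin -EFinB ifT; last by lra.
  by rewrite -EFinM lte_fin mulr_gt0//; lra.
apply: (@le_trans _ _ (\int[lebesgue_measure]_(t in [set` I]) (f t)%:E)%E).
  apply: (@ge0_le_integral _ (measurableTypeR R)) => //.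
  - by move=> *; rewrite lee_fin ltW.
  - exact: mf.
  - move=> p; rewrite /= in_itv/= => /andP[p1 p2]; rewrite lee_fin fE.
    rewrite ler_wpM2l ?(ltW K_gt0)//.
    by apply: ler_pM; rewrite ?powR_ge0//; apply: ge_powRB1 => //; lra.
apply: (@ge0_subset_integral _ (measurableTypeR R)) => //.
- exact: measurableI.
- exact: mf.
- by move=> *; rewrite lee_fin.
- move=> p; rewrite /= !in_itv/= => /andP[p1 p2].
  by split; apply/andP; split; lra.
Qed.

End beta_law.

(** * The Borel sets of the space of branching vectors *)

Lemma measurable_continuous_borel (R : realType) (T : ptopologicalType)
    (f : T -> R) :
  continuous f -> measurable_fun setT (f : borel T -> R).
Proof.
move=> cf; apply: (measurability _ (RGenOpens.measurableE R)) => _ [_ [a [b ->]] <-].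
rewrite setTI; apply: sub_sigma_algebra.
by apply: open_comp; [move=> v _; exact: cf|exact: interval_open].
Qed.

Section borel_qvec.
Context (R : realType) (h : nat).

Lemma qvec_cvg (F : set_system (qvec R h)) (v : qvec R h) : Filter F ->
  (forall y, (fun u : qvec R h => u y) @ F --> v y) -> F --> v.
Proof.
move=> FF Fv; apply/cvg_sup => y A [V] [[W] oW <-] Wv WA.
by apply: (filterS WA); apply: Fv; exact: open_nbhs_nbhs.
Qed.

Lemma qvec_eval_continuous (y : strings h) : continuous (fun v : qvec R h => v y).
Proof. exact: (@proj_continuous _ (fun=> R) y). Qed.

(** The product topology is coarser than the uniform one: points outside [U] at uniform distance
    below [1 / (n + 1)] from [v] would converge to [v] coordinatewise. *)
Lemma qvec_open_ball (U : set (qvec R h)) (v : qvec R h) : open U -> U v ->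
  exists2 e : R, 0 < e &
    forall u : qvec R h, (forall y, `|u y - v y| < e) -> U u.
Proof.
move=> oU Uv; apply: contrapT => nU.
have H (n : nat) : exists u : qvec R h,
    (forall y, `|u y - v y| < n.+1%:R^-1) /\ ~ U u.
  apply: contrapT => nu; apply: nU; exists n.+1%:R^-1; first by rewrite invr_gt0.
  by move=> u uv; apply: contrapT => nUu; apply: nu; exists u.
have [u_ uP] := choice H.
have : u_ @ \oo --> v.
  apply: qvec_cvg => y; apply/cvgrPdist_lt => e e0.
  have [N _ HN] := near_infty_natSinv_lt (PosNum e0).
  by exists N => // n Nn /=; rewrite distrC; exact: lt_trans ((uP n).1 y) (HN n Nn).
move=> /(_ U (open_nbhs_nbhs (conj oU Uv)))[N _ /(_ N (leqnn _))].
exact: (uP N).2.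
Qed.

Lemma measurable_qvec_eval (y : strings h) :
  measurable_fun setT (fun v : borel (qvec R h) => v y).
Proof. exact: measurable_continuous_borel (@qvec_eval_continuous y). Qed.

Lemma measurable_coord (w : seq bool) :
  measurable_fun setT (fun v : borel (qvec R h) => Defs.coord v w).
Proof.
rewrite /Defs.coord; case: insubP => [y _ _|_] /=; last exact: measurable_cst.
exact: measurable_qvec_eval.
Qed.

(** The sigma-algebra is generated by the open sets, not by the coordinates, so each open set is
    written as a countable union of boxes with rational centres. The centres are functions on the
    finite type [h.-bseq bool], which makes the index type countable. *)
Lemma measurable_to_qvec d (T : measurableType d) (g : T -> borel (qvec R h)) :
  (forall y, measurable_fun setT (fun x => g x y)) -> measurable_fun setT g.
Proof.
move=> mg; apply: (@measurability _ _ T (borel (qvec R h)) setT g open erefl) => _ [U oU <-]; rewrite setTI.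
pose box (i : {ffun h.-bseq bool -> rat} * nat) : set (qvec R h) :=
  [set u | forall y, `|u y - ratr (i.1 (insub_bseq h (val y)))| < i.2.+1%:R^-1].
have -> : g @^-1` U = \bigcup_(i in [set i | box i `<=` U]) g @^-1` box i.
  apply/seteqP; split => [x Ugx|x [i /= iU gx]]; last exact: iU.
  have [e e0 eU] := qvec_open_ball oU Ugx.
  (* Both [g x] and any other point of the box are within [1 / (n + 1) < e / 2] of the centre, hence
     within [e] of each other. *)
  pose n := Num.truncn (2 / e).
  have n0 : 0 < n.+1%:R^-1 :> R by rewrite invr_gt0.
  have ne : n.+1%:R^-1 < e / 2 :> R.
    by rewrite -[ltRHS]invf_div ltf_pV2 ?posrE ?divr_gt0//; exact: truncnS_gt.
  have H (b : h.-bseq bool) : exists q : rat,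
      `|Defs.coord (g x : qvec R h) b - ratr q| < n.+1%:R^-1.
    have [|q] := @rat_in_itvoo R (Defs.coord (g x : qvec R h) b - n.+1%:R^-1)
      (Defs.coord (g x : qvec R h) b + n.+1%:R^-1).
      by rewrite ltrD2l gt0_cp.
    by rewrite in_itv/= => /andP[q1 q2]; exists q; rewrite ltr_distl ltrBlDr q2 -ltrBlDr.
  have [q qP] := choice H.
  have qE (y : strings h) : `|g x y - ratr (q (insub_bseq h (val y)))| < n.+1%:R^-1.
    have := qP (insub_bseq h (val y)).
    have -> : insub_bseq h (val y) = val y :> seq bool.
      by rewrite /insub_bseq val_insubd; case: y => /= y /andP[_ ->].
    by rewrite /Defs.coord valK.
  exists (finfun q, n).
    move=> u /= uq; apply: eU => y.
    have := uq y; have := qE y; rewrite ffunE !ltr_distl.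
    move: (ratr _) (n.+1%:R^-1) ne => r e' ne.
    by move=> /andP[? ?] /andP[? ?]; apply/andP; split; lra.
  by move=> y /=; rewrite ffunE.
rewrite bigcup_mkcond; apply: countable_bigcupT_measurable => // i.
case: ifP => // _.
have -> : g @^-1` box i = \bigcap_y ((fun x => g x y) @^-1`
    [set r | `|r - ratr (i.1 (insub_bseq h (val y)))| < i.2.+1%:R^-1]).
  by apply/seteqP; split => [x gx y _|x gx y]; exact: gx.
rewrite -[X in measurable X]setCK setC_bigcap; apply: measurableC.
apply: countable_bigcupT_measurable => [|y].
  exact: (@countableP {y : seq bool | (0 < size y <= h)%N}).
apply: measurableC.
rewrite -[X in measurable X]setTI; apply: mg => //; apply: open_measurable.
rewrite (_ : [set r | _] = ball (ratr (i.1 (insub_bseq h (val y))) : R) i.2.+1%:R^-1).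
  exact: ball_open.
by apply/seteqP; split => r; rewrite /ball/= /ball_ /= distrC.
Qed.

End borel_qvec.

(** * The prior *)

Lemma measurable_forall_countable d (T : measurableType d) (I : countType)
    (A : I -> set T) :
  (forall i, measurable (A i)) -> measurable [set x | forall i, A i x].
Proof.
move=> mA; rewrite (_ : [set x | _] = ~` \bigcup_i ~` A i).
  apply: measurableC; apply: countable_bigcupT_measurable => // i.
  exact: measurableC.
rewrite setC_bigcup; apply/seteqP; split => [x Ax i _|x Ax i].
  by rewrite setCK; exact: Ax.
by rewrite -(setCK (A i)); exact: Ax.
Qed.

Lemma measurable_impl d (T : measurableType d) (P : Prop) (A : set T) :
  measurable A -> measurable [set x | P -> A x].
Proof.
move=> mA; have [p|np] := pselect P.
  rewrite (_ : [set x | _] = A)//.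
  by apply/seteqP; split => [x /(_ p)|x Ax _].
rewrite (_ : [set x | _] = setT)//.
by apply/seteqP; split => // x _ /np.
Qed.

Section graft.
Context (R : realType) (h : nat).

Lemma coordE (v : qvec R h) (w : seq bool) (hw : (0 < size w <= h)%N) :
  Defs.coord v w = v (exist _ w hw).
Proof. by rewrite /Defs.coord insubT. Qed.

Lemma coord_graft1 (x : R) (v0 v1 : borel (qvec R h)) b :
  Defs.coord (graft (x, v0, v1) : qvec R h.+1) [:: b] = if b then 1 - x else x.
Proof. by rewrite /Defs.coord insubT. Qed.

Lemma coord_graft_cons (x : R) (v0 v1 : borel (qvec R h)) b w : w != [::] ->
  Defs.coord (graft (x, v0, v1) : qvec R h.+1) (b :: w) =
  Defs.coord ((if b then v1 else v0) : qvec R h) w.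
Proof.
case: w => // c w _; rewrite /Defs.coord; case: insubP => [y _ yE|] /=.
  by rewrite /graft yE.
by rewrite /= -ltnNge ltnS => hw; rewrite insubF//= leqNgt hw.
Qed.

Lemma measurable_graft : measurable_fun setT (@graft R h).
Proof.
apply: measurable_to_qvec => y.
have mx : measurable_fun setT
    (fun t : R * borel (qvec R h) * borel (qvec R h) => t.1.1).
  exact: measurableT_comp measurable_fst measurable_fst.
case: y => -[|b [|c w]]// hy.
- rewrite (_ : (fun t => _) =
      fun t : R * borel (qvec R h) * borel (qvec R h) =>
        if b then 1 - t.1.1 else t.1.1); last by apply/funext => -[[x v0] v1].
  case: b {hy} => //; apply: measurable_funB => //; exact: measurable_cst.
- rewrite (_ : (fun t => _) =
      fun t : R * borel (qvec R h) * borel (qvec R h) =>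
        Defs.coord ((if b then t.2 else t.1.2) : qvec R h) (c :: w));
    last by apply/funext => -[[x v0] v1].
  case: b {hy}.
    exact: measurableT_comp (@measurable_coord R h _) measurable_snd.
  apply: (measurableT_comp (@measurable_coord R h (c :: w))).
  exact: measurableT_comp measurable_snd measurable_fst.
Qed.

End graft.

(** Stated for functions of strings rather than vectors, so that it passes to a subtree as
    [t \o cons b]. *)
Definition sibling_sum1 (R : realType) (h : nat) (t : seq bool -> R) :=
  forall y, (size y < h)%N -> [/\ 0 <= t (rcons y false), 0 <= t (rcons y true) &
    t (rcons y false) + t (rcons y true) = 1].

Definition above (R : realType) (h : nat) (c : R) (t : seq bool -> R) :
    set (borel (qvec R h)) :=
  [set v | forall y, (size y < h)%N -> forall b,
    c * t (rcons y b) <= Defs.coord (v : qvec R h) (rcons y b)].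
Arguments above {R} h c t _.

Definition stochastic_vecs (R : realType) (h : nat) : set (borel (qvec R h)) :=
  [set v | sibling_sum1 h (Defs.coord (v : qvec R h))].
Arguments stochastic_vecs R h _ : clear implicits.

Lemma measurable_above (R : realType) (h : nat) (c : R) (t : seq bool -> R) :
  measurable (above h c t).
Proof.
apply: measurable_forall_countable => y; apply: measurable_impl.
apply: measurable_forall_countable => b.
rewrite -[X in measurable X]setTI.
by apply: (measurable_fun_le (f := cst _)) => //; exact: measurable_coord.
Qed.

Lemma measurable_stochastic_vecs (R : realType) (h : nat) :
  measurable (stochastic_vecs R h).
Proof.
apply: measurable_forall_countable => y; apply: measurable_impl.
pose c b := (fun v : borel (qvec R h) => Defs.coord (v : qvec R h) (rcons y b)).
have mc b : measurable_fun setT (c b) by exact: measurable_coord.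
have m0 b : measurable [set v | 0 <= c b v].
  rewrite -[X in measurable X]setTI.
  by apply: (measurable_fun_le (f := cst _)).
have m1 : measurable [set v | c false v + c true v = 1].
  rewrite -[X in measurable X]setTI.
  exact: (measurable_funD (mc false) (mc true) measurableT (measurable_set1 1)).
have mB : measurable ([set v | 0 <= c false v] `&` [set v | 0 <= c true v] `&`
    [set v | c false v + c true v = 1]).
  by apply: measurableI => //; exact: measurableI.
apply: (eq_ind _ measurable mB).
by apply/seteqP; split => [v [[]]|v []].
Qed.

Lemma stochastic_graft (R : realType) (h : nat) (x : R) (v0 v1 : borel (qvec R h)) :
  0 <= x <= 1 -> stochastic_vecs R h v0 -> stochastic_vecs R h v1 ->
  stochastic_vecs R h.+1 (graft (x, v0, v1)).
Proof.
move=> /andP[x0 x1] S0 S1 [|b y] hy; rewrite ?rcons_cons.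
  by rewrite !coord_graft1; split; lra.
have nil c : rcons y c != [::] by case: y {hy}.
by rewrite !coord_graft_cons//; case: b hy => hy; [exact: S1|exact: S0].
Qed.

(** As the siblings of [t] sum to 1, the condition [1 - x >= c * t [:: true]] on the second child
    reads [x <= c * t [:: false] + (1 - c)]. The admissible [x] form an interval of length [1 - c]
    whatever [t] is, including the values 0 and 1. *)
Lemma above_graft (R : realType) (h : nat) (c x : R) (t : seq bool -> R)
    (v0 v1 : borel (qvec R h)) :
  sibling_sum1 h.+1 t -> c * t [:: false] <= x <= c * t [:: false] + (1 - c) ->
  above h c (t \o cons false) v0 -> above h c (t \o cons true) v1 ->
  above h.+1 c t (graft (x, v0, v1)).
Proof.
move=> St /andP[x0 x1] A0 A1 [|b y] hy d; rewrite ?rcons_cons.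
  rewrite coord_graft1; have [_ _ /=] := St [::] (ltn0Sn h).
  by case: d => //= ?; nra.
have nil : rcons y d != [::] by case: y {hy}.
by rewrite !coord_graft_cons//; case: b hy => hy; [exact: A1|exact: A0].
Qed.

Lemma coord_half (R : realType) (h : nat) (y : seq bool) (b : bool) :
  (size y < h)%N -> Defs.coord ((fun=> 2^-1) : qvec R h) (rcons y b) = 2^-1.
Proof. by move=> hy; rewrite /Defs.coord insubT// size_rcons. Qed.

Section prior.
Context (R : realType) (alpha u s : R).
Hypotheses (alpha0 : 0 < alpha) (u0 : 0 <= u) (s0 : 0 <= s).

Lemma graft_totalE (h : nat) (b : {finite_measure set R -> \bar R})
    (nu : {finite_measure set (borel (qvec R h)) -> \bar R}) :
  ((b \x nu) \x nu)%E setT = (b setT * nu setT * nu setT)%E.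
Proof.
rewrite -setXTT.
rewrite (@product_measure1E _ _ _ _ _ [the measure _ _ of (b \x nu)%E] nu)//.
by rewrite /= -setXTT product_measure1E.
Qed.

Lemma graft_finite_measure (h : nat)
    (b : {finite_measure set R -> \bar R})
    (nu : {finite_measure set (borel (qvec R h)) -> \bar R}) :
  exists m : {finite_measure set (borel (qvec R h.+1)) -> \bar R},
    (m : set (borel (qvec R h.+1)) -> \bar R) =
    pushforward ((b \x nu) \x nu)%E (@graft R h).
Proof.
apply: finite_measure_of.
- by rewrite measure0//; exact: measurable_graft.
- by move=> A; apply: measure_ge0; exact: measurable_graft.
- by apply: measure_semi_sigma_additive; exact: measurable_graft.
- rewrite /pushforward preimage_setT graft_totalE.
  by rewrite -ge0_fin_numE ?mule_ge0// !fin_numM// fin_num_measure.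
Qed.

Lemma prior_finite_measure (h : nat) :
  exists nu : {finite_measure set (borel (qvec R h)) -> \bar R},
    (nu : set (borel (qvec R h)) -> \bar R) = prior_at alpha u s h.
Proof.
elim: h => [|h [nu nuE]] /=.
  apply: finite_measure_of.
  - exact: measure0.
  - by move=> A; exact: measure_ge0.
  - exact: measure_semi_sigma_additive.
  - by rewrite diracT ltry.
have [b bE] := beta_law_finite_measure alpha0.
have [m mE] := graft_finite_measure b nu.
rewrite -nuE -bE -mE.
set x := (fun=> 2^-1) : borel (qvec R h.+1).
pose mu : {measure set (borel (qvec R h.+1)) -> \bar R} :=
  measure_add (mscale (NngNum u0) \d_x) (mscale (NngNum s0) m).
have <- : (mu : set (borel (qvec R h.+1)) -> \bar R) =
    (fun A => u%:E * \d_x A + s%:E * m A)%E.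
  by apply/funext => A; exact: measure_addE.
apply: finite_measure_of.
- exact: measure0.
- by move=> A; exact: measure_ge0.
- exact: measure_semi_sigma_additive.
- have -> : mu setT = (u%:E * \d_x setT + s%:E * m setT)%E by exact: measure_addE.
  rewrite diracT mule1 -ge0_fin_numE ?adde_ge0 ?mule_ge0//.
  by rewrite fin_numD fin_numM// fin_num_measure.
Qed.

(** One level of the recursion, as used by both inductions on the height below; it reduces them to
    rectangles in the arguments of [graft]. *)
Lemma prior_graft_rect (h : nat) (nu : {finite_measure set (borel (qvec R h)) -> \bar R})
    (nuE : (nu : set (borel (qvec R h)) -> \bar R) = prior_at alpha u s h)
    (I : set R) (A0 A1 : set (borel (qvec R h))) (A : set (borel (qvec R h.+1))) :
  measurable I -> measurable A0 -> measurable A1 -> measurable A ->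
  (forall x v0 v1, I x -> A0 v0 -> A1 v1 -> A (graft (x, v0, v1))) ->
  (u%:E * \d_((fun=> 2^-1%R) : borel (qvec R h.+1)) A +
   s%:E * (beta_law alpha alpha I * nu A0 * nu A1) <= prior_at alpha u s h.+1 A)%E.
Proof.
move=> mI mA0 mA1 mA IA /=; rewrite -nuE.
have [b bE] := beta_law_finite_measure alpha0; rewrite -bE.
apply: leeD => //; apply: lee_wpmul2l => //.
rewrite -product_measure1E//.
rewrite -(@product_measure1E _ _ _ _ _ [the measure _ _ of (b \x nu)%E] nu)//; last exact: measurableX.
rewrite /pushforward; apply: le_measure.
- by rewrite inE; apply: measurableX => //; exact: measurableX.
- by rewrite inE -[X in measurable X]setTI; exact: measurable_graft.
- by move=> [[x v0] v1] /= [[Ix A0v] A1v]; exact: IA.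
Qed.

Lemma half_stochastic (h : nat) : stochastic_vecs R h (fun=> 2^-1).
Proof. by move=> y hy; rewrite !coord_half//; split; lra. Qed.

(** In the form [nu setT <= nu S] the claim passes through the induction without knowledge of the
    total mass; finiteness of that mass then makes the complement null. *)
Lemma prior_stochastic (h : nat) :
  prior_at alpha u s h (~` stochastic_vecs R h) = 0%E.
Proof.
have [nu nuE] := prior_finite_measure h.
have mS := @measurable_stochastic_vecs R h.
suff H : (nu setT <= nu (stochastic_vecs R h))%E.
  rewrite -nuE.
  have : (nu setT = nu (stochastic_vecs R h) + nu (~` stochastic_vecs R h))%E.
    by rewrite -measureU ?setUv ?setICr//; exact: measurableC.
  move=> E; move: H; rewrite E -[leRHS]adde0 leeD2lE ?fin_num_measure//.
  by move=> H; apply/eqP; rewrite eq_le H measure_ge0.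
rewrite nuE {nu nuE mS}; elim: h => [|h IH]; first by rewrite /= !diracE !mem_set.
have [nu nuE] := prior_finite_measure h.
have mS := @measurable_stochastic_vecs R h.
apply: le_trans (@prior_graft_rect h nu nuE `]0, 1[%classic (stochastic_vecs R h)
  (stochastic_vecs R h) (stochastic_vecs R h.+1) (measurable_itv _) mS mS
  (@measurable_stochastic_vecs R h.+1) _); last first.
  move=> x v0 v1; rewrite /= in_itv/= => /andP[x0 x1]; apply: stochastic_graft.
  by rewrite !ltW.
have [b bE] := beta_law_finite_measure alpha0.
rewrite beta_law_unit_itv -bE /= -nuE -bE; apply: leeD.
  by rewrite !diracE !mem_set//; exact: half_stochastic.
apply: lee_wpmul2l => //.
rewrite /pushforward preimage_setT graft_totalE -nuE in IH *.
by rewrite !lee_pmul ?mule_ge0.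
Qed.

(** For [s > 0] the Beta component alone has positive mass, by induction on the two subtrees. For
    [s = 0] all mass sits at the constant vector 1/2, which equals [t] on the relevant strings and
    so belongs to the set. *)
Lemma prior_above (h : nat) (c : R) (t : seq bool -> R) : u + s = 1 ->
  0 < c < 1 -> sibling_sum1 h t ->
  (s = 0 -> forall y b, (size y < h)%N -> t (rcons y b) = 2^-1) ->
  (0 < prior_at alpha u s h (above h c t))%E.
Proof.
move=> us /andP[c0 c1]; elim: h t => [|h IH] t St deg.
  by rewrite /= diracE mem_set.
have [nu nuE] := prior_finite_measure h.
have [b bE] := beta_law_finite_measure alpha0.
have [t0 t1 t01] := St [::] (ltn0Sn h).
have St' b' : sibling_sum1 h (t \o cons b') by move=> y hy; exact: (St (b' :: y)).
apply: lt_le_trans (@prior_graft_rect h nu nuE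
  `[(c * t [:: false])%R, (c * t [:: false] + (1 - c))%R]%classic
  (above h c (t \o cons false)) (above h c (t \o cons true))
  (above h.+1 c t) (measurable_itv _) (@measurable_above _ _ _ _)
  (@measurable_above _ _ _ _) (@measurable_above _ _ _ _) _); last first.
  by move=> x v0 v1; rewrite /= in_itv/= => xI; exact: above_graft.
have [s00|sN0] := eqVneq s 0.
  have u1 : u = 1 by rewrite -us s00 addr0.
  rewrite s00 u1 mul0e adde0 mul1e diracE mem_set ?lte01// => y hy d.
  by rewrite coord_half// deg// ler_piMl ?invr_ge0// ltW.
apply: (@lt_le_trans _ _ (s%:E * (beta_law alpha alpha
  `[(c * t [:: false])%R, (c * t [:: false] + (1 - c))%R] *
  nu (above h c (t \o cons false)) * nu (above h c (t \o cons true))))%E); last first.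
  by rewrite leeDr// mule_ge0.
have s1 : 0 < s by rewrite lt_neqAle eq_sym sN0.
have IH' b' : (0 < nu (above h c (t \o cons b')))%E.
  by rewrite nuE; apply: IH => // s00; move/eqP: sN0.
rewrite !mule_gt0//; apply: beta_law_itv_gt0 => //; [exact: mulr_ge0 (ltW c0) _|lra|].
by move: t0 t1 t01 => /= ? ? ?; nra.
Qed.

End prior.

(** * Cells, prefixes and the likelihood *)

Section tree.
Context (R : realType) d (Gam : measurableType d) (vol : probability Gam R).
Context (m : nat) (cell : seq bool -> set Gam).
Hypothesis hcell : tree_partition vol m cell.

Lemma cell_rcons_sub z b : (size z < m)%N -> cell (rcons z b) `<=` cell z.
Proof. by move=> zm; rewrite (cell_split hcell zm); case: b; [right|left]. Qed.

Lemma cell_cat_sub z y : (size (z ++ y) <= m)%N -> cell (z ++ y) `<=` cell z.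
Proof.
elim/last_ind: y => [|y b IH]; first by rewrite cats0 => _ x.
rewrite -rcons_cat size_rcons => zym x /(cell_rcons_sub zym).
exact: IH (ltnW zym) x.
Qed.

Lemma cell_size_inj i x w w' : (i <= m)%N -> size w = i -> size w' = i ->
  cell w x -> cell w' x -> w = w'.
Proof.
elim: i w w' => [|i IH] w w' im; first by move=> /size0nil -> /size0nil ->.
case: (lastP w) => [//|y b]; case: (lastP w') => [//|y' b'].
rewrite !size_rcons => -[sy] -[sy'] cy cy'.
have ym : (size y < m)%N by rewrite sy.
have ym' : (size y' < m)%N by rewrite sy'.
have yy' := IH _ _ (ltnW im) sy sy' (cell_rcons_sub ym cy) (cell_rcons_sub ym' cy').
rewrite -{}yy' {sy' ym' y'} in cy' *; have D := cell_disjoint hcell ym.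
case: b b' cy cy' => -[]// c1 c2; exfalso;
  by have : (cell (rcons y false) `&` cell (rcons y true)) x by []; rewrite D.
Qed.

Lemma cell_cover i x : (i <= m)%N -> exists2 w, size w = i & cell w x.
Proof.
elim: i => [|i IH] im; first by exists [::] => //; rewrite (cell_nil hcell).
have [w sw cw] := IH (ltnW im).
have : (cell (rcons w false) `|` cell (rcons w true)) x.
  by rewrite -(cell_split hcell)// sw.
by case=> c; [exists (rcons w false)|exists (rcons w true)]; rewrite ?size_rcons ?sw.
Qed.

Lemma prefix_ofP i x : (i <= m)%N ->
  size (prefix_of cell i x) = i /\ cell (prefix_of cell i x) x.
Proof.
move=> im; have [w sw cw] := cell_cover x im.
have [] := @xgetPex _ [::] [set w | size w = i /\ cell w x] (ex_intro _ w (conj sw cw)).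
by [].
Qed.

Lemma prefix_of_cat z i x : (size z <= i)%N -> (i <= m)%N -> cell z x ->
  prefix_of cell i x = z ++ drop (size z) (prefix_of cell i x).
Proof.
move=> zi im cz; have [sp cp] := prefix_ofP x im.
have st : size (take (size z) (prefix_of cell i x)) = size z.
  by rewrite size_takel// sp.
rewrite -{1}(cat_take_drop (size z) (prefix_of cell i x)); congr (_ ++ _).
apply: (@cell_size_inj (size z) x) => //; first exact: leq_trans im.
by apply: (@cell_cat_sub _ (drop (size z) (prefix_of cell i x)));
  rewrite cat_take_drop// sp.
Qed.

(** On each level exactly one string has [x] in its cell, so a sum along the path of [x] is a sum
    over all nodes weighted by indicators. Added up over the data, the indicators become the counts
    [hits]. *)
Lemma sum_prefix_of z x (g : seq bool -> R) : (size z <= m)%N -> cell z x ->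
  \sum_((size z).+1 <= i < m.+1) g (drop (size z) (prefix_of cell i x)) =
  \sum_(k < m - size z) \sum_(y : k.-tuple bool) \sum_(b : bool)
    (x \in cell (z ++ rcons y b))%:R * g (rcons y b).
Proof.
move=> zm cz; rewrite -[(size z).+1]add1n big_addn subSn// big_add1/= big_mkord.
apply: eq_bigr => k _.
have km : (k.+1 + size z <= m)%N by rewrite -[leqRHS](subnK zm) leq_add2r.
have zk : (size z <= k.+1 + size z)%N by exact: leq_addl.
have [sp cp] := prefix_ofP x km.
have pE := prefix_of_cat zk km cz.
set p := drop (size z) (prefix_of cell (k.+1 + size z) x) in pE *.
have sp' : size p = k.+1 by rewrite size_drop sp addnK.
case/lastP: p sp' pE => [//|y0 b0]; rewrite size_rcons => -[sy0] pE.
have inE' (y : k.-tuple bool) b :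
    (x \in cell (z ++ rcons y b)) = ((y == y0 :> seq bool) && (b == b0)).
  apply/idP/idP => [/set_mem c|/andP[/eqP -> /eqP ->]]; last by rewrite inE -pE.
  have /(congr1 (drop (size z))) : z ++ rcons y b = z ++ rcons y0 b0.
    apply: (cell_size_inj km _ _ c); rewrite -?pE//.
    by rewrite size_cat size_rcons size_tuple addnC.
  by rewrite !drop_size_cat// => /rcons_inj[-> ->]; rewrite !eqxx.
rewrite (bigD1 (Tuple (introT eqP sy0)))//= [X in _ + X]big1 ?addr0; last first.
  move=> y yy0; rewrite big1// => b _; rewrite inE'.
  by rewrite -val_eqE/= in yy0; rewrite (negbTE yy0) mul0r.
rewrite (bigD1 b0)//= [X in _ + X]big1 ?addr0; last first.
  move=> b bb0; have := inE' (Tuple (introT eqP sy0)) b; rewrite /= => ->.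
  by rewrite (negbTE bb0) andbF mul0r.
by have := inE' (Tuple (introT eqP sy0)) b0; rewrite /= => ->; rewrite !eqxx mul1r.
Qed.

End tree.

Section node_sum.
Context (R : realType) (h : nat).
Implicit Types (F G : seq bool -> bool -> R).

(** A nonempty string is indexed by its parent and its last bit, so that siblings appear together
    and cancellations between them can be used at each parent. *)
Definition node_sum F : R :=
  \sum_(k < h) \sum_(y : k.-tuple bool) \sum_(b : bool) F y b.

Lemma node_sum0 : node_sum (fun _ _ => 0) = 0.
Proof. by rewrite /node_sum; do 3 (apply: big1 => ? _). Qed.

Lemma node_sumD F G :
  node_sum (fun y b => F y b + G y b) = node_sum F + node_sum G.
Proof.
rewrite /node_sum -big_split; apply: eq_bigr => k _.
rewrite -big_split; apply: eq_bigr => y _; exact: big_split.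
Qed.

Lemma node_sumZ c F : node_sum (fun y b => c * F y b) = c * node_sum F.
Proof.
rewrite /node_sum mulr_sumr; apply: eq_bigr => k _.
by rewrite mulr_sumr; apply: eq_bigr => y _; rewrite mulr_sumr.
Qed.

Lemma eq_node_sum F G : (forall y b, (size y < h)%N -> F y b = G y b) ->
  node_sum F = node_sum G.
Proof.
by move=> FG; do 3 (apply: eq_bigr => ? _); apply: FG; rewrite size_tuple.
Qed.

Lemma ler_node_sum F G : (forall y b, (size y < h)%N -> F y b <= G y b) ->
  node_sum F <= node_sum G.
Proof.
by move=> FG; do 3 (apply: ler_sum => ? _); apply: FG; rewrite size_tuple.
Qed.

Lemma node_sum_pairs F G : (forall y, (size y < h)%N ->
    F y false + F y true = G y false + G y true) -> node_sum F = node_sum G.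
Proof.
move=> FG; do 2 (apply: eq_bigr => ? _); rewrite !big_bool /= addrC [RHS]addrC.
by apply: FG; rewrite size_tuple.
Qed.

Lemma ge_node_sum_term F y b : (forall y b, (size y < h)%N -> 0 <= F y b) ->
  (size y < h)%N -> F y b <= node_sum F.
Proof.
move=> F0 yh; rewrite /node_sum (bigD1 (Ordinal yh))//=.
rewrite (bigD1 (in_tuple y))//= (bigD1 b)//= -!addrA lerDl.
by rewrite !addr_ge0//; do ?(apply: sumr_ge0 => ? _); apply: F0; rewrite ?size_tuple.
Qed.

Lemma node_sum_cvg0 (F : nat -> seq bool -> bool -> R) :
  (forall y b, (size y < h)%N -> F n y b @[n --> \oo] --> 0) ->
  node_sum (F n) @[n --> \oo] --> 0.
Proof.
move=> F0; rewrite -[X in _ --> X]node_sum0 /node_sum.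
have csum (I : finType) (G : I -> nat -> R) (l : I -> R) :
    (forall i, G i n @[n --> \oo] --> l i) ->
    (\sum_i G i n) @[n --> \oo] --> \sum_i l i.
  by move=> Gl; apply: cvg_big => [|i _]; [exact: add_continuous|exact: Gl].
by do 3 (apply: (@csum) => ?); apply: F0; rewrite size_tuple.
Qed.

End node_sum.

Lemma le_mul_expR_sqrt (R : realType) (t v : R) : 0 < t -> 0 <= v ->
  v <= t * expR (2 * (Num.sqrt (v / t) - 1)).
Proof.
move=> t0 v0; set r := Num.sqrt _.
have vE : v = t * r ^+ 2.
  by rewrite sqr_sqrtr ?divr_ge0 ?(ltW t0)// mulrC divfK// gt_eqF.
rewrite [leLHS]vE ler_pM2l// expRM_natl lerXn2r ?nnegrE ?sqrtr_ge0 ?expR_ge0//.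
by apply: le_trans (expR_ge1Dx _); rewrite addrC subrK.
Qed.

Section likelihood_bounds.
Context (R : realType) d (Gam : measurableType d) (vol : probability Gam R).
Context (m : nat) (cell : seq bool -> set Gam).
Hypothesis hcell : tree_partition vol m cell.
Context (z : seq bool).
Hypothesis hz : (size z <= m)%N.
Let h := (m - size z)%N.
Implicit Types (D : seq Gam) (v t : qvec R h).

Definition hits (w : seq bool) D : nat := count (fun x => x \in cell (z ++ w)) D.

Lemma drop_prefixP i x : (size z < i)%N -> (i <= m)%N -> cell z x ->
  exists y b, [/\ drop (size z) (prefix_of cell i x) = rcons y b,
    (size y < h)%N & cell (z ++ rcons y b) x].
Proof.
move=> zi im cz; have [sp cp] := prefix_ofP hcell x im.
have pE := prefix_of_cat hcell (ltnW zi) im cz.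
set p := drop _ _ in pE *.
have sp' : size p = (i - size z)%N by rewrite size_drop sp.
case/lastP: p sp' pE => [/=/esym/eqP|y b]; first by rewrite subn_eq0 leqNgt zi.
rewrite size_rcons => sy pE; exists y, b; split=> //; last by rewrite -pE.
by rewrite sy leq_sub2r.
Qed.

Lemma likelihood_cons x D v : likelihood cell (x :: D) v =
  (if x \in cell z then point_likelihood cell v x else 1) * likelihood cell D v.
Proof.
by rewrite /likelihood /restrict_data/=; case: ifP; rewrite ?big_cons ?mul1r.
Qed.

Lemma point_likelihood_ge c v t x : 0 <= c -> cell z x ->
  (forall y b, (size y < h)%N -> 0 <= Defs.coord t (rcons y b)) ->
  (forall y b, (size y < h)%N ->
    c * Defs.coord t (rcons y b) <= Defs.coord v (rcons y b)) ->
  c ^+ h * point_likelihood cell t x <= point_likelihood cell v x.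
Proof.
move=> c0 cz t0 tv; rewrite /point_likelihood.
have -> : c ^+ h = \prod_((size z).+1 <= i < m.+1) c by rewrite prodr_const_nat subSS.
rewrite -big_split.
rewrite big_nat [leRHS]big_nat; apply: ler_prod => i /andP[zi im].
have [y [b [-> yh _]]] := drop_prefixP zi im cz.
rewrite !mulr_ge0 ?t0//= mulrCA ler_wpM2l//; exact: tv.
Qed.

(** A point outside [cell z] has factor 1 on both sides, and [c ^+ h <= 1] lets it be charged like
    the others. The exponent is then the full sample size, the scale of the exponential bounds to
    come. *)
Lemma likelihood_ge c v t D : 0 <= c -> c <= 1 ->
  (forall y b, (size y < h)%N -> 0 <= Defs.coord t (rcons y b)) ->
  (forall y b, (size y < h)%N ->
    c * Defs.coord t (rcons y b) <= Defs.coord v (rcons y b)) ->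
  (c ^+ h) ^+ size D * likelihood cell D t <= likelihood cell D v.
Proof.
move=> c0 c1 t0 tv.
have P0 x : cell z x -> 0 <= point_likelihood cell t x.
  move=> cz; rewrite /point_likelihood big_nat; apply: prodr_ge0 => i /andP[zi im].
  by have [y [b [-> yh _]]] := drop_prefixP zi im cz; rewrite mulr_ge0 ?t0.
have ch0 : 0 <= c ^+ h by rewrite exprn_ge0.
have L0 E : 0 <= likelihood cell E t.
  elim: E => [|x E IH]; first by rewrite /likelihood big_nil.
  by rewrite likelihood_cons mulr_ge0//; case: ifPn => // /set_mem/P0.
elim: D => [|x D IH]; first by rewrite expr0 mul1r /likelihood !big_nil.
rewrite !likelihood_cons exprS mulrACA; apply: ler_pM => //.
- by rewrite mulr_ge0//; case: ifPn => // /set_mem/P0.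
- by rewrite mulr_ge0// exprn_ge0.
- case: ifPn => [/set_mem cz|_]; first exact: point_likelihood_ge.
  by rewrite mulr1 exprn_ile1.
Qed.

Lemma point_likelihood_le v t x : cell z x ->
  (forall y b, (size y < h)%N -> 0 <= Defs.coord v (rcons y b)) ->
  (forall y b, (size y < h)%N -> cell (z ++ rcons y b) x ->
    0 < Defs.coord t (rcons y b)) ->
  point_likelihood cell v x <= point_likelihood cell t x *
    expR (2 * node_sum h (fun y b => (x \in cell (z ++ rcons y b))%:R *
      (Num.sqrt (Defs.coord v (rcons y b) / Defs.coord t (rcons y b)) - 1))).
Proof.
move=> cz v0 t0.
pose g w := Num.sqrt (Defs.coord v w / Defs.coord t w) - 1.
rewrite -[node_sum _ _](sum_prefix_of hcell g hz cz) mulr_sumr expR_sum.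
rewrite /point_likelihood -big_split big_nat [leRHS]big_nat.
apply: ler_prod => i /andP[zi im].
have [y [b [-> yh cx]]] := drop_prefixP zi im cz.
rewrite mulr_ge0 ?v0//= -mulrA ler_pM2l//; apply: le_mul_expR_sqrt; [exact: t0|exact: v0].
Qed.

(** [t] may vanish on strings without data: the quotient by 0 is then 0, and its weight [hits] is 0
    as well. Positivity at [t] is included because the bound is later used as one on the ratio. *)
Lemma likelihood_le v t D :
  (forall y b, (size y < h)%N -> 0 <= Defs.coord v (rcons y b)) ->
  (forall y b, (size y < h)%N -> (0 < hits (rcons y b) D)%N ->
    0 < Defs.coord t (rcons y b)) ->
  0 < likelihood cell D t /\
  0 <= likelihood cell D v <= likelihood cell D t *
    expR (2 * node_sum h (fun y b => (hits (rcons y b) D)%:R *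
      (Num.sqrt (Defs.coord v (rcons y b) / Defs.coord t (rcons y b)) - 1))).
Proof.
move=> v0; elim: D => [|x D IH] t0.
  rewrite /likelihood !big_nil; split => //.
  rewrite (_ : node_sum _ _ = 0) ?mulr0 ?expR0 ?mulr1 ?lexx ?ler01//.
  by rewrite -[RHS](node_sum0 _ h); apply: eq_node_sum => *; rewrite mul0r.
have [|L0 /andP[Lv0 Lv]] := IH.
  by move=> y b yh hy; apply: t0 => //; rewrite /hits/= ltn_addl.
have t0' y b : (size y < h)%N -> cell (z ++ rcons y b) x ->
    0 < Defs.coord t (rcons y b).
  by move=> yh cx; apply: t0 => //; rewrite /hits/= mem_set.
pose G := fun y b => Num.sqrt (Defs.coord v (rcons y b) / Defs.coord t (rcons y b)) - 1.
have -> : node_sum h (fun y b => (hits (rcons y b) (x :: D))%:R * G y b) =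
  node_sum h (fun y b => (x \in cell (z ++ rcons y b))%:R * G y b) +
  node_sum h (fun y b => (hits (rcons y b) D)%:R * G y b).
  by rewrite -node_sumD; apply: eq_node_sum => y b _; rewrite -mulrDl -natrD.
rewrite !likelihood_cons mulrDr expRD mulrACA.
case: ifPn => [/set_mem cz|ncz].
  split.
    rewrite mulr_gt0// /point_likelihood big_nat prodr_gt0// => i /andP[zi im].
    by have [y [b [-> yh cx]]] := drop_prefixP zi im cz; rewrite mulr_gt0 ?t0'.
  have P0 : 0 <= point_likelihood cell v x.
    rewrite /point_likelihood big_nat prodr_ge0// => i /andP[zi im].
    by have [y [b [-> yh cx]]] := drop_prefixP zi im cz; rewrite mulr_ge0 ?v0.
  by rewrite mulr_ge0//= ler_pM//; exact: point_likelihood_le.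
rewrite !mul1r; split => //; rewrite Lv0/= (_ : node_sum _ _ = 0).
  by rewrite mulr0 expR0 mul1r.
(* A point outside [cell z] lies in no cell below [z], so it adds to no count. *)
rewrite -[RHS](node_sum0 _ h); apply: eq_node_sum => y b yh.
rewrite memNset ?mul0r// => c; move/negP: ncz; apply; rewrite inE.
apply: (cell_cat_sub hcell) c; rewrite size_cat size_rcons.
by move: yh; rewrite /h ltn_subRL addnS.
Qed.

End likelihood_bounds.

(** * Hellinger distances and the exponent of the likelihood ratio *)

Lemma sqr_sqrtB_ge (R : realType) (t v : R) : 0 <= t <= 1 -> 0 <= v <= 1 ->
  (v - t) ^+ 2 / 4 <= (Num.sqrt v - Num.sqrt t) ^+ 2.
Proof.
move=> /andP[t0 t1] /andP[v0 v1].
have st0 := sqrtr_ge0 t; have sv0 := sqrtr_ge0 v.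
have st1 : Num.sqrt t <= 1 by rewrite -sqrtr1 ler_wsqrtr.
have sv1 : Num.sqrt v <= 1 by rewrite -sqrtr1 ler_wsqrtr.
rewrite -{1}(sqr_sqrtr t0) -{1}(sqr_sqrtr v0).
move: (Num.sqrt t) (Num.sqrt v) st0 sv0 st1 sv1 => a b a0 b0 a1 b1.
(* With [a] and [b] the square roots, [b ^+ 2 - a ^+ 2] factors as [(b - a) * (b + a)] with
   [b + a <= 2]; hence the 4. *)
rewrite subr_sqr exprMn ler_pdivrMr// ler_wpM2l ?sqr_ge0//; nra.
Qed.

Lemma sibling_sum1_itv (R : realType) (h : nat) (t : seq bool -> R) y b :
  sibling_sum1 h t -> (size y < h)%N -> 0 <= t (rcons y b) <= 1.
Proof.
move=> St yh; have [t0 t1 t01] := St y yh.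
by case: b; apply/andP; split=> //; lra.
Qed.

Section exponent.
Context (R : realType) (h : nat) (Q t v : seq bool -> R).
Hypotheses (Qt : forall y b, (size y < h)%N -> Q (rcons y b) = Q y * t (rcons y b))
  (Q0 : forall y, (size y < h)%N -> 0 <= Q y)
  (St : sibling_sum1 h t) (Sv : sibling_sum1 h v).

Let g y b := Num.sqrt (v (rcons y b) / t (rcons y b)) - 1.

(* The linear parts [v - t] cancel between siblings, which leaves minus half
   the squared Hellinger distances. *)
Lemma node_sum_hellinger :
  node_sum h (fun y b => Q (rcons y b) * g y b) =
  - (2^-1 * node_sum h (fun y b =>
      Q y * (Num.sqrt (v (rcons y b)) - Num.sqrt (t (rcons y b))) ^+ 2)).
Proof.
rewrite -mulNr -node_sumZ; apply: node_sum_pairs => y yh.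
have term b : Q (rcons y b) * g y b = Q y * (2^-1 * (v (rcons y b) - t (rcons y b))) +
  - 2^-1 * (Q y * (Num.sqrt (v (rcons y b)) - Num.sqrt (t (rcons y b))) ^+ 2).
  rewrite Qt// /g.
  have /andP[t0 _] := sibling_sum1_itv b St yh.
  have /andP[v0 _] := sibling_sum1_itv b Sv yh.
  move: (t _) (v _) t0 v0 => a w; rewrite le_eqVlt => /predU1P[<-|a0] w0.
    (* Where [t] vanishes, the left side is 0 through its factor [t], and the linear and the
       quadratic term on the right cancel. *)
    by rewrite invr0 !mulr0 sqrtr0 !subr0 mul0r sqr_sqrtr//; ring.
  have sa : Num.sqrt a != 0 by rewrite gt_eqF// sqrtr_gt0.
  have aE := sqr_sqrtr (ltW a0); have wE := sqr_sqrtr w0.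
  rewrite sqrtrM// sqrtrV ?(ltW a0)//.
  by move: (Num.sqrt a) (Num.sqrt w) sa aE wE => r p r0 <- <-; field.
have [_ _ t01] := St yh; have [_ _ v01] := Sv yh.
rewrite !term; nra.
Qed.

(** The frequency is split as [(N / n - Q) + Q]. In the first part [g] is bounded by
    [1 + sqrt (1 / t)], free of [v]. The second part is minus half a sum of nonnegative terms, one
    of which is at least [q * e ^+ 2 / 4]; this yields the 8. *)
Lemma node_sum_hits_le (N : seq bool -> nat) (n : nat) (q e : R) y0 b0 :
  (0 < n)%N -> 0 <= q -> 0 <= e -> (forall y, (size y < h)%N -> q <= Q y) ->
  (size y0 < h)%N -> e <= `|v (rcons y0 b0) - t (rcons y0 b0)| ->
  node_sum h (fun y b => (N (rcons y b))%:R * g y b) <=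
  n%:R * (node_sum h (fun y b => `|(N (rcons y b))%:R / n%:R - Q (rcons y b)| *
    (1 + Num.sqrt (t (rcons y b))^-1)) - q * e ^+ 2 / 8).
Proof.
move=> n0 q0 e0 qQ y0h evt.
have nN0 : n%:R != 0 :> R by rewrite pnatr_eq0 -lt0n.
have -> : node_sum h (fun y b => (N (rcons y b))%:R * g y b) =
   n%:R * (node_sum h (fun y b => ((N (rcons y b))%:R / n%:R - Q (rcons y b)) * g y b) +
           node_sum h (fun y b => Q (rcons y b) * g y b)).
  rewrite -node_sumD -node_sumZ; apply: eq_node_sum => y b _.
  by field.
rewrite ler_pM2l ?ltr0n//; apply: lerD.
  apply: ler_node_sum => y b yh; apply: (le_trans (ler_norm _)).
  rewrite normrM ler_wpM2l// /g.
  have /andP[t0 _] := sibling_sum1_itv b St yh.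
  have /andP[v0 v1] := sibling_sum1_itv b Sv yh.
  apply: (le_trans (ler_normB _ _)); rewrite normr1 addrC lerD2l.
  rewrite ger0_norm ?sqrtr_ge0// ler_wsqrtr//.
  by rewrite ler_piMl// invr_ge0.
rewrite node_sum_hellinger lerN2.
pose F y b := Q y * (Num.sqrt (v (rcons y b)) - Num.sqrt (t (rcons y b))) ^+ 2.
have F0 y b : (size y < h)%N -> 0 <= F y b.
  by move=> yh; rewrite mulr_ge0 ?sqr_ge0 ?Q0.
have := ge_node_sum_term b0 F0 y0h.
suff : q * e ^+ 2 / 4 <= F y0 b0 by lra.
rewrite /F -mulrA; apply: ler_pM; rewrite ?qQ ?divr_ge0 ?sqr_ge0//.
apply: le_trans (sqr_sqrtB_ge (sibling_sum1_itv b0 St y0h) (sibling_sum1_itv b0 Sv y0h)).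
by rewrite ler_pM2r ?invr_gt0// -[leRHS]real_normK ?num_real// lerXn2r ?nnegrE.
Qed.

End exponent.

(** * Law of large numbers for cell frequencies *)

Section frequency_moments.
Context (R : realType) d (Om : measurableType d) (P : probability Om R).
Context (B : nat -> set Om) (p : R).
Hypotheses (mB : forall i, measurable (B i)) (PB : forall i, P (B i) = p%:E).
Hypothesis PBB : forall i j, i != j -> P (B i `&` B j) = (p ^+ 2)%:E.

Definition hit_count (n : nat) (om : Om) : R := \sum_(i < n) \1_(B i) om.

Lemma hit_count_ge0 n om : 0 <= hit_count n om.
Proof. by apply: sumr_ge0. Qed.

Lemma measurable_hit_count n : measurable_fun setT (hit_count n).
Proof. by apply: measurable_sum => i; exact: measurable_indic. Qed.

Lemma integral_hit_count n : (\int[P]_om (hit_count n om)%:E = (n%:R * p)%:E)%E.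
Proof.
under eq_integral do rewrite -sumEFin.
rewrite ge0_integral_sum//; last first.
  by move=> i; apply/measurable_EFinP; exact: measurable_indic.
rewrite (eq_bigr (fun=> p%:E)).
  by rewrite sumEFin sumr_const card_ord mulr_natl.
by move=> i _; rewrite integral_indic// setIT; exact: PB.
Qed.

Lemma hit_count_sqrE n om : ((hit_count n om ^+ 2)%:E =
  \sum_(i < n) \sum_(j < n) (\1_(B i `&` B j) om)%:E)%E.
Proof.
rewrite expr2 /hit_count mulr_suml -sumEFin; apply: eq_bigr => i _.
rewrite mulr_sumr -sumEFin; apply: eq_bigr => j _.
by rewrite indicI.
Qed.

Lemma integral_hit_count_sqr n :
  (\int[P]_om (hit_count n om ^+ 2)%:E = (n%:R * (n%:R * p ^+ 2 + (p - p ^+ 2)))%:E)%E.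
Proof.
under eq_integral do rewrite hit_count_sqrE.
have mI i j : measurable_fun setT (fun om => (\1_(B i `&` B j) om : R)%:E).
  by apply/measurable_EFinP; apply: measurable_indic; exact: measurableI.
rewrite ge0_integral_sum//; last first.
- by move=> i om _; apply: sume_ge0 => j _; rewrite lee_fin.
- by move=> i; apply: emeasurable_sum => j; exact: mI.
rewrite (eq_bigr (fun=> (n%:R * p ^+ 2 + (p - p ^+ 2))%:E)).
  by rewrite sumEFin sumr_const card_ord -[(_ + _) *+ n]mulr_natl.
move=> i _; rewrite ge0_integral_sum//.
rewrite (eq_bigr (fun j => (p ^+ 2 + (i == j)%:R * (p - p ^+ 2))%:E)).
  rewrite sumEFin big_split/= sumr_const card_ord -[_ ^+ 2 *+ n]mulr_natl (bigD1 i)//= eqxx mul1r.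
  by rewrite big1 ?addr0// => j; rewrite eq_sym => /negbTE ->; rewrite mul0r.
move=> j _; transitivity (P (B i `&` B j)).
  by rewrite integral_indic ?setIT//; exact: measurableI.
have [->|ij] := eqVneq i j; first by rewrite setIid PB mul1r addrC subrK.
by rewrite PBB// mul0r addr0.
Qed.

Lemma integral_hit_count_var n :
  (\int[P]_om ((hit_count n om - n%:R * p) ^+ 2)%:E = (n%:R * (p - p ^+ 2))%:E)%E.
Proof.
have p0 : 0 <= p by rewrite -lee_fin -(PB 0%N) measure_ge0.
have mS := @measurable_hit_count n.
have mSp : measurable_fun setT (fun om => hit_count n om - n%:R * p).
  by apply: measurable_funB => //; exact: measurable_cst.
have np0 : 0 <= 2 * (n%:R * p) by rewrite !mulr_ge0.
(* The cross term stays on the left, so that every integrand is nonnegative and additivity requires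
   no integrability. *)
have E : (\int[P]_om ((hit_count n om - n%:R * p) ^+ 2)%:E +
    (2 * (n%:R * p) * (n%:R * p))%:E =
    (n%:R * (n%:R * p ^+ 2 + (p - p ^+ 2)))%:E + ((n%:R * p) ^+ 2)%:E)%E.
  rewrite (EFinM (2 * (n%:R * p))) -integral_hit_count -integral_hit_count_sqr.
  rewrite -ge0_integralZl//; last first.
  - by move=> om _; rewrite lee_fin hit_count_ge0.
  - exact/measurable_EFinP.
  rewrite -ge0_integralD//; last 4 first.
  - by move=> om _; rewrite lee_fin sqr_ge0.
  - by apply/measurable_EFinP; exact: measurable_funX.
  - by move=> om _; rewrite -EFinM lee_fin mulr_ge0// hit_count_ge0.
  - by apply: emeasurable_funM; [exact: measurable_cst|exact/measurable_EFinP].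
  transitivity (\int[P]_om ((hit_count n om ^+ 2)%:E + ((n%:R * p) ^+ 2)%:E))%E.
    by apply: eq_integral => om _; rewrite -EFinM -!EFinD; congr EFin; ring.
  rewrite ge0_integralD//; last 3 first.
  - by move=> om _; rewrite lee_fin sqr_ge0.
  - by apply/measurable_EFinP; exact: measurable_funX.
  - by move=> om _; rewrite lee_fin sqr_ge0.
  by rewrite integral_cst//= probability_setT mule1.
have Ifin : (\int[P]_om ((hit_count n om - n%:R * p) ^+ 2)%:E \is a fin_num)%E.
  by move: E; case: (\int[P]_om _)%E.
move: E; rewrite -(fineK Ifin) -!EFinD => -[E]; congr EFin.
by apply: (addIr (2 * (n%:R * p) * (n%:R * p))); rewrite E; ring.
Qed.

(** The variance [n * (p - p ^+ 2)] is bounded by [n], which makes the estimate independent of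
    [p]. *)
Lemma hit_count_chebyshev n (e : R) : (0 < n)%N -> 0 < e ->
  (P [set om | (e * n%:R <= `|hit_count n om - n%:R * p|)%R]
     <= ((e ^+ 2 * n%:R)^-1)%:E)%E.
Proof.
move=> n0 e0.
have nR : 0 < n%:R :> R by rewrite ltr0n.
have p0 : 0 <= p by rewrite -lee_fin -(PB 0%N) measure_ge0.
have p1 : p <= 1 by rewrite -lee_fin -(PB 0%N) probability_le1.
have mS := @measurable_hit_count n.
have mSp : measurable_fun setT (fun om => hit_count n om - n%:R * p).
  by apply: measurable_funB => //; exact: measurable_cst.
set E := [set om | _].
have mE : measurable E.
  rewrite -[E]setTI; apply: (measurable_fun_le (f := cst _)) => //.
  exact: measurableT_comp (@normr_measurable _ _) mSp.
have H : (((e * n%:R) ^+ 2)%:E * P E <= (n%:R * (p - p ^+ 2))%:E)%E.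
  rewrite -integral_hit_count_var -integral_cst//.
  apply: (@le_trans _ _ (\int[P]_(om in E) ((hit_count n om - n%:R * p) ^+ 2)%:E)%E).
    apply: ge0_le_integral => //.
    - by move=> om _; rewrite lee_fin sqr_ge0.
    - apply/measurable_EFinP; apply: measurable_funTS; exact: measurable_funX.
    - move=> om Eom; rewrite lee_fin -[leRHS]real_normK ?num_real//.
      by rewrite lerXn2r ?nnegrE ?normr_ge0// mulr_ge0 ?ltW.
  apply: ge0_subset_integral => //.
  - by apply/measurable_EFinP; exact: measurable_funX.
  - by move=> om _; rewrite lee_fin sqr_ge0.
have PE : P E \is a fin_num by exact: fin_num_measure.
rewrite -(fineK PE) -EFinM !lee_fin in H *.
have enn : 0 < e * n%:R by rewrite mulr_gt0.
rewrite -(ler_pM2l (exprn_gt0 2 enn)); apply: (le_trans H).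
have -> : (e * n%:R) ^+ 2 * (e ^+ 2 * n%:R)^-1 = n%:R.
  by field; rewrite (gt_eqF e0) pnatr_eq0 -lt0n n0.
by rewrite ler_piMr// ?ltW//; nra.
Qed.

End frequency_moments.

Lemma sqr_bracket (n : nat) : exists k, (k ^ 2 <= n < k.+1 ^ 2)%N.
Proof.
elim: n => [|n [k /andP[kn nk]]]; first by exists 0%N.
have [h|h] := leqP (k.+1 ^ 2) n.+1; last by exists k; rewrite h (leqW kn).
exists k.+1; rewrite h/=; apply: leq_ltn_trans nk _.
by rewrite ltn_sqr.
Qed.

(* [c] is squeezed between its values at consecutive squares, and
   [(k + 1) ^ 2 / k ^ 2 --> 1]. *)
Lemma cvg_along_squares (R : realType) (c : nat -> R) (p : R) :
  {homo c : m n / (m <= n)%N >-> m <= n} -> 0 <= p <= 1 ->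
  (forall e, 0 < e -> exists K : nat, forall k, (K <= k)%N ->
    `|c (k.+1 ^ 2)%N - (k.+1 ^ 2)%:R * p| <= e * (k.+1 ^ 2)%:R) ->
  c n / n%:R @[n --> \oo] --> p.
Proof.
move=> cinc /andP[p0 p1] csq; apply/cvgrPdist_le => e e0.
have e8 : 0 < e / 8 by rewrite divr_gt0.
have [K HK] := csq _ e8.
(* For [k >= M] the control holds at both [k ^ 2] and [(k + 1) ^ 2], and [6 <= e * k]. The gap
   [2 * k + 1 <= 3 * k] between the squares is then at most [(e / 2) * k ^ 2], while
   [(k + 1) ^ 2 <= 4 * k ^ 2] turns the error [e / 8] into [e / 2]. *)
pose M := (maxn K (Num.truncn (6 / e))).+2.
exists (M ^ 2)%N => // n /= Mn.
have [k /andP[kn nk]] := sqr_bracket n.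
have Mk : (M <= k)%N.
  by rewrite -ltnS -ltn_sqr; exact: leq_ltn_trans nk.
have k0 : (0 < k)%N by exact: leq_trans Mk.
have Kk : (K < k)%N.
  by apply: leq_trans Mk; rewrite /M !ltnS leqW// leq_maxl.
have ek : 6 <= e * k%:R.
  rewrite mulrC -ler_pdivrMr//; apply: (le_trans (ltW (truncnS_gt _))).
  by rewrite ler_nat; apply: leq_trans Mk; rewrite /M !ltnS leqW// leq_maxr.
have H1 := HK k (ltnW Kk); have H2 : `|c (k ^ 2)%N - (k ^ 2)%:R * p| <= e / 8 * (k ^ 2)%:R.
  by have := HK k.-1; rewrite prednK//; apply; rewrite -ltnS prednK.
have c1 := cinc _ _ kn; have c2 := cinc _ _ (ltnW nk).
have n0 : 0 < n%:R :> R by rewrite ltr0n (leq_trans _ kn)// expn_gt0 k0.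
rewrite -(ler_pM2r n0) -[X in _ * X <= _]gtr0_norm// -normrM mulrBl divfK ?gt_eqF//.
have kn' : k%:R ^+ 2 <= n%:R :> R by rewrite -natrX ler_nat.
have nk' : n%:R <= (k%:R + 1) ^+ 2 :> R by rewrite natr1 -natrX ler_nat ltnW.
have k1 : 1 <= k%:R :> R by rewrite ler1n.
rewrite !natrX -natr1 in H1 H2.
move: H1 H2 ek kn' nk' k1 c1 c2; rewrite !ler_norml.
move: (c _) (c _) (c _) (k%:R : R) (n%:R : R) n0 => a b f x y y0.
move=> /andP[h1 h2] /andP[h3 h4] ek xy yx x1 ac cb.
have q1 : 6 * x <= e * x ^+ 2 by rewrite expr2 mulrA ler_wpM2r//; lra.
have q2 : (x + 1) ^+ 2 <= 4 * x ^+ 2 by nra.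
have q3 : p * (x + 1) ^+ 2 <= p * x ^+ 2 + (2 * x + 1) by nra.
have q4 : e * (x + 1) ^+ 2 <= 4 * (e * x ^+ 2) by nra.
have q5 : e * x ^+ 2 <= e * y by rewrite ler_pM2l.
have q6 : p * x ^+ 2 <= p * y by rewrite ler_wpM2l.
have q7 : p * y <= p * (x + 1) ^+ 2 by rewrite ler_wpM2l.
by apply/andP; split; nra.
Qed.

Lemma sum_inv_sqr_le (R : realType) (n : nat) :
  \sum_(0 <= k < n) (k.+1%:R ^+ 2)^-1 <= 2 :> R.
Proof.
case: n => [|n]; first by rewrite big_geq.
(* The strengthened bound telescopes: [1 / (x + 1) ^ 2 <= 1 / x - 1 / (x + 1)]. *)
suff : \sum_(0 <= k < n.+1) (k.+1%:R ^+ 2)^-1 <= 2 - n.+1%:R^-1 :> R.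
  by move=> /le_trans; apply; rewrite lerBlDr lerDl invr_ge0.
elim: n => [|n IH]; first by rewrite big_nat1 expr1n invr1; lra.
rewrite big_nat_recr//=; apply: (le_trans (lerD IH (lexx _))).
have x1 : 1 <= n.+1%:R :> R by rewrite ler1n.
rewrite -[n.+2%:R]natr1; move: (n.+1%:R : R) x1 => x x1; have x0 : 0 < x by lra.
have h : x^-1 - (x + 1)^-1 = (x * (x + 1))^-1.
  by field; apply/andP; split; rewrite gt_eqF//; lra.
suff : ((x + 1) ^+ 2)^-1 <= (x * (x + 1))^-1 by rewrite -h => ?; lra.
by rewrite lef_pV2 ?posrE ?mulr_gt0 ?exprn_gt0//; nra.
Qed.

Section frequency.
Context (R : realType) d (Om : measurableType d) (P : probability Om R).
Context (B : nat -> set Om) (p : R).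
Hypotheses (mB : forall i, measurable (B i)) (PB : forall i, P (B i) = p%:E).
Hypothesis PBB : forall i j, i != j -> P (B i `&` B j) = (p ^+ 2)%:E.

(** The Chebyshev bound [1 / (e ^ 2 * n)] is not summable over all [n], but it is along the squares,
    where Borel-Cantelli applies. *)
Lemma hit_count_squares_ae (e : R) : 0 < e ->
  {ae P, forall om, exists K : nat, forall k, (K <= k)%N ->
    `|hit_count R B (k.+1 ^ 2) om - (k.+1 ^ 2)%:R * p| <= e * (k.+1 ^ 2)%:R}.
Proof.
move=> e0.
pose F (k : nat) : set Om :=
  [set om | e * (k.+1 ^ 2)%:R <= `|hit_count R B (k.+1 ^ 2) om - (k.+1 ^ 2)%:R * p|].
have mF k : measurable (F k).
  have mS : measurable_fun setT
      (fun om => hit_count R B (k.+1 ^ 2) om - (k.+1 ^ 2)%:R * p).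
    by apply: measurable_funB; [exact: measurable_hit_count|exact: measurable_cst].
  rewrite -[F k]setTI; apply: (measurable_fun_le (f := cst _)) => //.
  exact: measurableT_comp (@normr_measurable _ _) mS.
have PF k : (P (F k) <= (e ^- 2 * (k.+1%:R ^+ 2)^-1)%:E)%E.
  rewrite -natrX -invfM; exact: (hit_count_chebyshev mB PB PBB).
have sumF : (\sum_(k <oo) P (F k) < +oo)%E.
  apply: (@le_lt_trans _ _ (e ^- 2 * 2)%:E); last exact: ltry.
  apply: lime_le; first by apply: is_cvg_nneseries => *; exact: measure_ge0.
  apply: nearW => n; apply: (@le_trans _ _
      (\sum_(0 <= k < n) (e ^- 2 * (k.+1%:R ^+ 2)^-1)%:E)%E).
    by apply: lee_sum => k _; exact: PF.
  rewrite sumEFin lee_fin -mulr_sumr ler_wpM2l ?sum_inv_sqr_le//.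
  by rewrite invr_ge0 exprn_ge0 ?ltW.
exists (lim_sup_set F); split.
- by apply: bigcapT_measurable => n; apply: bigcup_measurable => k _; exact: mF.
- exact: lim_sup_set_cvg0.
- move=> om nK n _; apply: contrapT => nF; apply: nK; exists n => k nk.
  rewrite leNgt; apply/negP => Fk; apply: nF; exists k => //.
  exact: ltW.
Qed.

Lemma hit_count_ae :
  {ae P, forall om, hit_count R B n om / n%:R @[n --> \oo] --> p}.
Proof.
have p01 : 0 <= p <= 1.
  by rewrite -!lee_fin -(PB 0%N) measure_ge0 probability_le1.
(* Countably many tolerances [1 / (j + 1)] share one null set and suffice for every [e]. *)
have : {ae P, forall om, forall j : nat, exists K : nat, forall k, (K <= k)%N ->
    `|hit_count R B (k.+1 ^ 2) om - (k.+1 ^ 2)%:R * p| <= j.+1%:R^-1 * (k.+1 ^ 2)%:R}.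
  by apply: ae_foralln => j; apply: hit_count_squares_ae; rewrite invr_gt0.
apply: filterS => om H; apply: cvg_along_squares => //.
  move=> i j ij; rewrite /hit_count -!(big_mkord xpredT (fun i => \1_(B i) om)).
  by rewrite (big_cat_nat _ ij)//= lerDl; apply: sumr_ge0.
move=> e e0; have [K HK] := H (Num.truncn e^-1); exists K => k Kk.
apply: (le_trans (HK k Kk)); rewrite ler_wpM2r// -[leRHS]invrK lef_pV2 ?posrE ?invr_gt0//.
exact/ltW/truncnS_gt.
Qed.

End frequency.

Section iid.
Context (R : realType) d d' (Om : measurableType d) (T : measurableType d').
Context (P : probability Om R) (X : nat -> {RV P >-> T}) (q : probability T R).
Hypothesis hX : iid_from X q.

Lemma iid_preimage i A : measurable A -> P (X i @^-1` A) = q A.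
Proof. exact: (hX.1 i A). Qed.

Lemma iid_preimageI i j A : i != j -> measurable A ->
  P (X i @^-1` A `&` X j @^-1` A) = (q A * q A)%E.
Proof.
move=> ij mA; pose n := (maxn i j).+1.
have iN : (i < n)%N by rewrite ltnS leq_maxl.
have jN : (j < n)%N by rewrite ltnS leq_maxr.
(* Independence is given for initial segments; the indices other than [i] and [j] receive the full
   space and contribute the factor 1. *)
pose F k := if (k == i) || (k == j) then A else setT.
have mF k : measurable (F k) by rewrite /F; case: ifP.
have := hX.2 n F mF; rewrite (_ : \bigcap_(k < n) _ = X i @^-1` A `&` X j @^-1` A).
  move=> ->; rewrite (bigD1 (Ordinal iN))//= (bigD1 (Ordinal jN))//=; last first.
    by rewrite -val_eqE/= eq_sym.
  rewrite [X in (_ * (_ * X))%E]big1 ?mule1; last first.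
    move=> k /andP[]; rewrite -!val_eqE/= => ki kj.
    by rewrite /F (negbTE ki) (negbTE kj)/= preimage_setT probability_setT.
  by rewrite /F !eqxx orbT/= !iid_preimage.
apply/seteqP; split => [om h|om [h1 h2] k _].
  by split; [have := h i iN|have := h j jN]; rewrite /= /F eqxx ?orbT.
rewrite /= /F; case: ifP => // /orP[/eqP ->|/eqP ->] //.
Qed.

Lemma hit_count_sample n A om :
  hit_count R (fun i => X i @^-1` A) n om =
  (count (fun x => x \in A) (sample X n om))%:R.
Proof.
rewrite /hit_count /sample -sum1_count big_map natr_sum.
rewrite -(big_mkord xpredT (fun i => \1_(X i @^-1` A) om)) /index_iota subn0.
rewrite [RHS]big_mkcond; apply: eq_bigr => i _; rewrite indicE /=.
rewrite (_ : (om \in X i @^-1` A) = (X i om \in A)); first by case: ifP.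
by apply/idP/idP; rewrite !inE.
Qed.

Lemma iid_frequency_ae A : measurable A ->
  {ae P, forall om, (count (fun x => x \in A) (sample X n om))%:R / n%:R
    @[n --> \oo] --> fine (q A)}.
Proof.
move=> mA; have qA : (fine (q A))%:E = q A by rewrite fineK// fin_num_measure.
have mB i : measurable (X i @^-1` A).
  by rewrite -[X in measurable X]setTI; exact: measurable_funP.
have PB i : P (X i @^-1` A) = (fine (q A))%:E by rewrite qA iid_preimage.
have PBB i j : i != j -> P (X i @^-1` A `&` X j @^-1` A) = ((fine (q A)) ^+ 2)%:E.
  by move=> ij; rewrite expr2 EFinM qA iid_preimageI.
apply: filterS (hit_count_ae mB PB PBB) => om.
by under eq_cvg do rewrite hit_count_sample.
Qed.

Lemma iid_null_ae A : measurable A -> q A = 0%E ->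
  {ae P, forall om, forall i, ~ A (X i om)}.
Proof.
move=> mA qA0; apply: ae_foralln => i; exists (X i @^-1` A); split.
- by rewrite -[X in measurable X]setTI; exact: measurable_funP.
- by rewrite -qA0; exact: iid_preimage.
- by move=> om /contrapT.
Qed.

End iid.

Lemma ae_forall_countable d (T : measurableType d) (R : realType)
    (mu : {measure set T -> \bar R}) (I : countType) (Q : I -> T -> Prop) :
  (forall i, {ae mu, forall x, Q i x}) -> {ae mu, forall x, forall i, Q i x}.
Proof.
move=> H; have : {ae mu, forall x, forall n, oapp (Q ^~ x) True (unpickle n)}.
  apply: ae_foralln => n; case: (unpickle n) => [i|] /=; first exact: H.
  exact: filterE.
by apply: filterS => x Hx i; have := Hx (pickle i); rewrite pickleK.
Qed.

(** * Weak convergence to a point mass *)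

Section eq_set_fun_integral.
Import HBNNSimple.

(* Nothing is assumed of the two set functions: the integral only evaluates
   them on measurable sets. *)
Lemma eq_set_fun_integral d (T : measurableType d) (R : realType)
    (m1 m2 : set T -> \bar R) (f : T -> \bar R) :
  (forall A, measurable A -> m1 A = m2 A) ->
  (\int[m1]_x f x = \int[m2]_x f x)%E.
Proof.
move=> m12.
have E (h : {nnsfun T >-> R}) : sintegral m1 h = sintegral m2 h.
  by apply: eq_fsbigr => r _; rewrite m12.
by rewrite /integral; congr (ereal_sup _ - ereal_sup _)%E; apply: eq_imagel => h _.
Qed.

End eq_set_fun_integral.

Lemma cvg_weakly_dirac (R : realType) (T : ptopologicalType)
    (mu_ : nat -> set (borel T) -> \bar R) (x : borel T) :
  (forall n, exists nu : {finite_measure set (borel T) -> \bar R},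
    (forall A, measurable A -> nu A = mu_ n A) /\ nu setT = 1%E) ->
  (forall U : set T, open U -> U x -> mu_ n (~` U) @[n --> \oo] --> 0%E) ->
  cvg_weakly mu_ (\d_x).
Proof.
move=> /choice[nu_ nuP] muU f cf [M fM].
have mf := measurable_continuous_borel cf.
have mEf : measurable_fun setT (EFin \o f : borel T -> \bar R) by exact/measurable_EFinP.
have M0 : 0 <= M by exact: le_trans (fM x).
rewrite integral_dirac// diracT mul1e.
have intf n : (nu_ n).-integrable setT (EFin \o f : borel T -> \bar R).
  apply: measurable_bounded_integrable => //.
    by rewrite -ge0_fin_numE//; exact: fin_num_measure.
  by exists M; split; [exact: num_real|move=> y /ltW My v _; exact: le_trans (fM v) My].
have bound n (U : set T) e : open U -> 0 <= e -> (forall v, U v -> `|f v - f x| <= e) ->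
    (`|\int[nu_ n]_v (f v)%:E - (f x)%:E| <= e%:E + (2 * M)%:E * mu_ n (~` U))%E.
  move=> oU e0 Ue.
  have mU : measurable (~` U : set (borel T)).
    by apply: measurableC; exact: sub_sigma_algebra.
  have intc : (nu_ n).-integrable setT (EFin \o cst (f x) : borel T -> \bar R).
    exact: finite_measure_integrable_cst.
  have -> : ((f x)%:E = \int[nu_ n]_v (cst (f x) v)%:E)%E.
    by rewrite -[RHS]/(\int[nu_ n]_v cst (f x)%:E v)%E integral_cst//= (nuP n).2 mule1.
  rewrite -integralB_EFin//; last exact: intf.
  have mfB : measurable_fun setT (fun v : borel T => (f v)%:E - (cst (f x) v)%:E)%E.
    apply: emeasurable_funB; first exact: mEf.
    by apply/measurable_EFinP; exact: measurable_cst.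
  apply: (le_trans (le_abse_integral _ _ _)) => //.
  apply: (@le_trans _ _ (\int[nu_ n]_v (e%:E + (2 * M)%:E * (\1_(~` U) v)%:E))%E).
    apply: ge0_le_integral => //.
    - exact: measurableT_comp.
    - apply: emeasurable_funD; first exact: measurable_cst.
      apply: emeasurable_funM; first exact: measurable_cst.
      by apply/measurable_EFinP; exact: measurable_indic.
    - move=> v _; rewrite -EFinB -EFinM -EFinD lee_fin indicE.
      have [/set_mem Uv|nUv] := boolP (v \in U).
        by rewrite memNset ?mulr0 ?addr0; [exact: Ue|move=> /(_ Uv)].
      rewrite mem_set ?mulr1; last by move: nUv; rewrite notin_setE.
      apply: (le_trans (ler_normB _ _)); have := fM v; have := fM x => /=; lra.
  rewrite ge0_integralD//; last 2 first.
  - by move=> v _; rewrite -EFinM lee_fin !mulr_ge0.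
  - apply: emeasurable_funM; first exact: measurable_cst.
    by apply/measurable_EFinP; exact: measurable_indic.
  rewrite integral_cst//= (nuP n).2 mule1 ge0_integralZl//; last 2 first.
  - by apply/measurable_EFinP; exact: measurable_indic.
  - by rewrite lee_fin mulr_ge0.
  by rewrite integral_indic// setIT -(nuP n).1.
have E n : (\int[mu_ n]_v (f v)%:E = \int[nu_ n]_v (f v)%:E)%E.
  by apply/esym/eq_set_fun_integral => A mA; exact: (nuP n).1.
under eq_cvg do rewrite E.
have Ifin n : (\int[nu_ n]_v (f v)%:E \is a fin_num)%E.
  exact: integrable_fin_num (intf n).
apply/fine_cvgP; split; first exact: nearW.
apply/cvgrPdist_le => e e0.
have [U [oU Ux] Ue] : exists2 U : set T, open U /\ U x &
    forall v, U v -> `|f v - f x| <= e / 2.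
  have : nbhs (x : T) [set v | `|f x - f v| <= e / 2].
    have /cvgrPdist_le := cf x; apply.
    by rewrite divr_gt0.
  rewrite nbhsE => -[U [oU Ux] UE]; exists U => // v /UE /=.
  by rewrite distrC.
have /fine_cvgP[_ muU0] := muU U oU Ux.
(* This makes the [2 * M] term at most [e / 2]; [M + 1] covers [M = 0]. *)
have d0 : 0 < e / (4 * (M + 1)) by rewrite divr_gt0// mulr_gt0//; lra.
move/cvgrPdist_le : muU0 => /(_ _ d0) near0.
near=> n.
have := bound n U (e / 2) oU _ Ue; rewrite -(fineK (Ifin n)).
have mU : measurable (~` U : set (borel T)).
  by apply: measurableC; exact: sub_sigma_algebra.
have mufin : mu_ n (~` U) \is a fin_num by rewrite -(nuP n).1// fin_num_measure.
rewrite -(fineK mufin) -EFinB /= -EFinM -EFinD lee_fin => /(_ _) H.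
rewrite distrC; apply: (le_trans (H _)); first by rewrite ltW// divr_gt0.
have mu0 : 0 <= fine (mu_ n (~` U)).
  by rewrite fine_ge0// -(nuP n).1// measure_ge0.
have : fine (mu_ n (~` U)) <= e / (4 * (M + 1)).
  rewrite -[leLHS]ger0_norm// -normrN -sub0r.
  by near: n.
rewrite ler_pdivlMr; last by rewrite mulr_gt0//; lra.
by move: (fine _) mu0 => r r0; nra.
Unshelve. all: by end_near. Qed.

(** * The posterior *)

Section posterior.
Context (R : realType) d (Gam : measurableType d) (vol : probability Gam R).
Context (m : nat) (cell : seq bool -> set Gam).
Hypothesis hcell : tree_partition vol m cell.
Context (z : seq bool).
Hypothesis hz : (size z <= m)%N.
Context (alpha u s : R).
Hypotheses (alpha0 : 0 < alpha) (u0 : 0 <= u) (s0 : 0 <= s).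
Let h := (m - size z)%N.
Context (t : qvec R h) (D : seq Gam).
Hypothesis St : sibling_sum1 h (Defs.coord t).
Hypothesis hD : forall y b, (size y < h)%N ->
  (0 < hits cell z (rcons y b) D)%N -> 0 < Defs.coord t (rcons y b).
Context (nu : {finite_measure set (borel (qvec R h)) -> \bar R}).
Hypothesis nuE : (nu : set (borel (qvec R h)) -> \bar R) = prior_at alpha u s h.

Let L : borel (qvec R h) -> R := fun v => likelihood cell D (v : qvec R h).
Let S := stochastic_vecs R h.
(** Off [S] the likelihood can be negative or unbounded. Setting it to 0 there changes it only on a
    null set of the prior and gives access to the lemmas on nonnegative integrands. *)
Let L0 : borel (qvec R h) -> R := L \_ S.

Let mS : measurable S := @measurable_stochastic_vecs R h.

Lemma measurable_likelihood : measurable_fun setT L.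
Proof.
rewrite /L /likelihood; apply: measurable_prod => x _.
rewrite /point_likelihood; apply: measurable_prod => i _.
by apply: measurable_funM; [exact: measurable_cst|exact: measurable_coord].
Qed.

Let S_ge0 v y b : S v -> (size y < h)%N ->
  0 <= Defs.coord (v : qvec R h) (rcons y b) <= 1.
Proof. by move=> Sv yh; exact: sibling_sum1_itv Sv yh. Qed.

Let S_coord_ge0 v : S v -> forall y b, (size y < h)%N ->
  0 <= Defs.coord (v : qvec R h) (rcons y b).
Proof. by move=> Sv y b yh; have /andP[] := S_ge0 b Sv yh. Qed.

Let Lt_gt0 : 0 < L t.
Proof. by have [] := likelihood_le hcell hz (S_coord_ge0 St) hD. Qed.

(** Makes the evidence finite, without which [fine] would lose it. The bound drops the [-1] from the
    exponent and uses [v <= 1]. *)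
Lemma likelihood_bounded : exists M, forall v, S v -> L v <= M.
Proof.
exists (L t * expR (2 * node_sum h (fun y b => (hits cell z (rcons y b) D)%:R *
  Num.sqrt (Defs.coord t (rcons y b))^-1))) => v Sv.
have [_ /andP[_ Lv]] := likelihood_le hcell hz (S_coord_ge0 Sv) hD.
apply: (le_trans Lv); rewrite ler_pM2l// ler_expR ler_pM2l//.
apply: ler_node_sum => y b yh; apply: ler_wpM2l => //.
have /andP[v0 v1] := S_ge0 b Sv yh; have /andP[t0 _] := S_ge0 b St yh.
rewrite lerBlDr; apply: (@le_trans _ _ (Num.sqrt (Defs.coord t (rcons y b))^-1)).
  by rewrite ler_wsqrtr// ler_piMl// invr_ge0.
by rewrite lerDl.
Qed.

Let L0_ge0 v : 0 <= L0 v.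
Proof.
rewrite /L0 patchE; case: ifPn => // /set_mem Sv.
by have [_ /andP[]] := likelihood_le hcell hz (S_coord_ge0 Sv) hD.
Qed.

Let mL0 : measurable_fun setT L0.
Proof.
by apply/measurable_restrict => //; apply: measurable_funTS; exact: measurable_likelihood.
Qed.

Let mEL0 (A : set (borel (qvec R h))) : measurable_fun A (EFin \o L0).
Proof. by apply/measurable_EFinP; exact: measurable_funTS mL0. Qed.

Let nuS : nu (~` S) = 0%E.
Proof. by rewrite nuE; exact: prior_stochastic. Qed.

Lemma integral_likelihoodE A : measurable A ->
  (\int[prior_at alpha u s h]_(v in A) (L v)%:E = \int[nu]_(v in A) (L0 v)%:E)%E.
Proof.
move=> mA; rewrite -nuE; apply: ae_eq_integral => //.
  by apply/measurable_EFinP; exact: measurable_funTS measurable_likelihood.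
exists (~` S); split => //; first exact: measurableC.
move=> v /= H Sv; apply: H => _; rewrite /L0 patchE mem_set//.
Qed.

Lemma integral_L0_le (K : R) A : measurable A -> 0 <= K ->
  (forall v, A v -> S v -> L v <= K) ->
  (\int[nu]_(v in A) (L0 v)%:E <= K%:E * nu setT)%E.
Proof.
move=> mA K0 LK; apply: (@le_trans _ _ (\int[nu]_(v in A) cst K%:E v)%E).
  apply: ge0_le_integral => //.
  - by move=> v _; rewrite lee_fin.
  - move=> v Av; rewrite /= lee_fin /L0 patchE; case: ifPn => // /set_mem Sv.
    exact: LK.
rewrite integral_cst//=; apply: lee_wpmul2l; first by rewrite lee_fin.
by apply: le_measure; rewrite ?inE.
Qed.

Lemma integral_L0_fin A : measurable A -> (\int[nu]_(v in A) (L0 v)%:E \is a fin_num)%E.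
Proof.
move=> mA; rewrite ge0_fin_numE; last by apply: integral_ge0 => v _; rewrite lee_fin.
have [M LM] := likelihood_bounded.
apply: (@le_lt_trans _ _ ((Num.max 0 M)%:E * nu setT)%E).
  by apply: integral_L0_le => //; [rewrite le_max lexx|move=> v _ Sv; rewrite le_max LM ?orbT].
by rewrite lte_mul_pinfty ?lee_fin ?le_max ?lexx// -ge0_fin_numE// fin_num_measure.
Qed.

Lemma evidence_ge (c : R) : 0 <= c <= 1 ->
  (((c ^+ h) ^+ size D * L t)%:E * nu (above h c (Defs.coord t)) <=
   \int[nu]_v (L0 v)%:E)%E.
Proof.
move=> /andP[c0 c1]; set W := above h c (Defs.coord t).
have mW : measurable W by exact: measurable_above.
(* [L0] vanishes off [S], so only the part of [W] inside [S] can bound the evidence. *)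
have nuW : (nu W <= nu (W `&` S))%E.
  rewrite -[leRHS]adde0 -nuS; apply: (@le_trans _ _ (nu ((W `&` S) `|` ~` S))).
    apply: le_measure; rewrite ?inE//.
      by apply: measurableU; [exact: measurableI|exact: measurableC].
    by move=> v Wv; have [Sv|nSv] := pselect (S v); [left|right].
  by apply: measureU2; [exact: measurableI|exact: measurableC].
have K0 : 0 <= (c ^+ h) ^+ size D * L t by rewrite mulr_ge0 ?exprn_ge0// ltW.
apply: (@le_trans _ _ (((c ^+ h) ^+ size D * L t)%:E * nu (W `&` S))%E).
  by apply: lee_wpmul2l => //; rewrite lee_fin.
have mWS : measurable (W `&` S) by exact: measurableI.
rewrite -[X in (X <= _)%E](@integral_cst _ _ _ nu _ mWS).
apply: (@le_trans _ _ (\int[nu]_(v in W `&` S) (L0 v)%:E)%E).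
  apply: ge0_le_integral => //.
  - move=> v [Wv Sv]; rewrite /= lee_fin /L0 patchE mem_set//.
    by apply: (likelihood_ge hcell D c0 c1 (S_coord_ge0 St)) => y b yh; exact: Wv.
by apply: ge0_subset_integral => // v _; rewrite lee_fin.
Qed.

Context (c : R).
Hypotheses (c01 : 0 < c <= 1) (nuc : (0 < nu (above h c (Defs.coord t)))%E).

Let E := fine (\int[nu]_v (L0 v)%:E)%E.
Let V := fine (nu (above h c (Defs.coord t))).

Let V_gt0 : 0 < V.
Proof. by rewrite fine_gt0// nuc -ge0_fin_numE// fin_num_measure//; exact: measurable_above. Qed.

Let E_ge : (c ^+ h) ^+ size D * L t * V <= E.
Proof.
have /andP[c0 c1] := c01.
rewrite -lee_fin fineK ?integral_L0_fin// EFinM fineK.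
  by apply: evidence_ge; rewrite c1 ltW.
by rewrite fin_num_measure//; exact: measurable_above.
Qed.

Let ch_gt0 : 0 < (c ^+ h) ^+ size D.
Proof. by have /andP[c0 _] := c01; rewrite !exprn_gt0. Qed.

Let E_gt0 : 0 < E.
Proof. by apply: lt_le_trans E_ge; rewrite !mulr_gt0. Qed.

Lemma posteriorE A : measurable A ->
  posterior m cell alpha u s z D A = (\int[nu]_(v in A) (L0 v)%:E * (E^-1)%:E)%E.
Proof.
move=> mA; rewrite /posterior /evidence /prior.
by rewrite -[LHS]/((\int[prior_at alpha u s h]_(v in A) (L v)%:E) *
  (fine (\int[prior_at alpha u s h]_v (L v)%:E))^-1%:E)%E !integral_likelihoodE.
Qed.

(** A normalised density with respect to [nu]: the total mass is 1 because the evidence is finite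
    and, by the lower bound over [above], positive. *)
Lemma posterior_finite_measure :
  exists mu : {finite_measure set (borel (qvec R h)) -> \bar R},
    (forall A, measurable A -> mu A = posterior m cell alpha u s z D A) /\
    mu setT = 1%E.
Proof.
have EV0 : (0 <= (E^-1)%:E)%E by rewrite lee_fin invr_ge0 ltW.
have intE A : measurable A -> (\int[nu]_(v in A) ((L0 v)%:E * (E^-1)%:E) =
    \int[nu]_(v in A) (L0 v)%:E * (E^-1)%:E)%E.
  by move=> mA; rewrite ge0_integralZr// => v _; rewrite lee_fin.
have T1 : (\int[nu]_v (L0 v)%:E * (E^-1)%:E = 1)%E.
  by rewrite -(fineK (integral_L0_fin measurableT)) -EFinM mulfV// gt_eqF.
have [| | |mu muE] := @density_finite_measure _ _ _ nu
  (fun v => (L0 v)%:E * (E^-1)%:E)%E.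
- by apply: emeasurable_funM; [exact: mEL0|exact: measurable_cst].
- by move=> v; rewrite mule_ge0// lee_fin.
- by rewrite intE// T1 ltry.
exists mu; rewrite muE; split=> [A mA|]; first by rewrite posteriorE// intE.
by rewrite intE.
Qed.

(** The data-dependent factor [L t] cancels against the same factor in the lower bound on the
    evidence. *)
Lemma posterior_le (K : R) A : measurable A -> 0 <= K ->
  (forall v, A v -> S v -> L v <= L t * K) ->
  (posterior m cell alpha u s z D A <=
   (K * fine (nu setT) / ((c ^+ h) ^+ size D * V))%:E)%E.
Proof.
move=> mA K0 LK; rewrite posteriorE//.
have H : (\int[nu]_(v in A) (L0 v)%:E <= (L t * K)%:E * nu setT)%E.
  by apply: integral_L0_le => //; rewrite mulr_ge0// ltW.
rewrite -(fineK (integral_L0_fin mA)) -(fineK (fin_num_measure nu setT measurableT)) in H *.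
rewrite -!EFinM !lee_fin in H *.
rewrite ler_pdivrMr//; apply: (le_trans H).
have N0 : 0 <= K * fine (nu setT) by rewrite mulr_ge0 ?fine_ge0.
have -> : L t * K * fine (nu setT) = K * fine (nu setT) * L t by ring.
rewrite -[leRHS]mulrA ler_wpM2l// ler_pdivlMl ?mulr_gt0//.
by rewrite mulrAC.
Qed.

End posterior.

(** * Exponential decay of the posterior away from the true vector *)

Lemma exists_positive_lower_bound (R : realType) (h : nat) (Q : seq bool -> R) :
  (forall y, (size y < h)%N -> 0 < Q y) ->
  exists2 q, 0 < q & forall y, (size y < h)%N -> q <= Q y.
Proof.
(* Each [Q y] is at least the inverse of one plus the sum of all the inverses. The strings of length
   exactly [h] in [h.-bseq bool] are given weight 0. *)
move=> Q0; pose F (b : h.-bseq bool) : R := if (size b < h)%N then (Q b)^-1 else 0.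
have F0 b : 0 <= F b by rewrite /F; case: ifP => // /Q0 /ltW; rewrite invr_ge0.
have S0 : 0 <= \sum_b F b by apply: sumr_ge0.
exists (1 + \sum_b F b)^-1; first by rewrite invr_gt0; lra.
move=> y yh; rewrite -[leRHS]invrK lef_pV2 ?posrE ?invr_gt0 ?Q0//; last by lra.
have -> : (Q y)^-1 = F (Bseq (ltnW yh)) by rewrite /F yh.
by rewrite (bigD1 (Bseq (ltnW yh)))//= addrCA lerDl addr_ge0// sumr_ge0.
Qed.

Section concentration.
Context (R : realType) d (Gam : measurableType d) (vol : probability Gam R).
Context (m : nat) (cell : seq bool -> set Gam).
Hypothesis hcell : tree_partition vol m cell.
Context (z : seq bool).
Hypothesis hz : (size z <= m)%N.
Context (alpha u s : R).
Hypotheses (alpha0 : 0 < alpha) (u0 : 0 <= u) (s0 : 0 <= s) (us : u + s = 1).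
Let h := (m - size z)%N.
Context (t : qvec R h) (Q : seq bool -> R).
Hypothesis Q0 : forall y, (size y < h)%N -> 0 < Q y.
Hypothesis Qt : forall y b, (size y < h)%N ->
  Q (rcons y b) = Q y * Defs.coord t (rcons y b).
Hypothesis St : sibling_sum1 h (Defs.coord t).
Hypothesis deg : s = 0 -> forall y b, (size y < h)%N ->
  Defs.coord t (rcons y b) = 2^-1.
Context (D : nat -> seq Gam).
Hypothesis sizeD : forall n, size (D n) = n.
Hypothesis freqD : forall y b, (size y < h)%N ->
  (hits cell z (rcons y b) (D n))%:R / n%:R @[n --> \oo] --> Q (rcons y b).
Hypothesis hD : forall n y b, (size y < h)%N ->
  (0 < hits cell z (rcons y b) (D n))%N -> 0 < Defs.coord t (rcons y b).

(** The sampling error in the exponent; being free of [v], it is uniform over the vectors away from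
    [t]. *)
Let err (n : nat) : R := node_sum h (fun y b =>
  `|(hits cell z (rcons y b) (D n))%:R / n%:R - Q (rcons y b)| *
  (1 + Num.sqrt (Defs.coord t (rcons y b))^-1)).

Let err_cvg0 : err n @[n --> \oo] --> 0.
Proof.
apply: (@node_sum_cvg0 R h (fun n y b =>
  `|(hits cell z (rcons y b) (D n))%:R / n%:R - Q (rcons y b)| *
  (1 + Num.sqrt (Defs.coord t (rcons y b))^-1))) => y b yh.
rewrite -(mul0r (1 + Num.sqrt (Defs.coord t (rcons y b))^-1)).
apply: cvgM; last exact: cvg_cst.
rewrite -(normr0 R) -(subrr (Q (rcons y b))); apply: cvg_norm.
by apply: cvgB; [exact: freqD|exact: cvg_cst].
Qed.

Lemma likelihood_away_le (n : nat) (q e : R) (v : qvec R h) (w : strings h) :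
  (0 < n)%N -> 0 <= q -> 0 <= e -> (forall y, (size y < h)%N -> q <= Q y) ->
  stochastic_vecs R h v -> e <= `|v w - t w| ->
  likelihood cell (D n) v <= likelihood cell (D n) t *
    expR (2 * (n%:R * (err n - q * e ^+ 2 / 8))).
Proof.
move=> n0 q0 e0 qQ Sv evt.
have Sv0 y b : (size y < h)%N -> 0 <= Defs.coord v (rcons y b).
  by move=> yh; have /andP[] := sibling_sum1_itv b Sv yh.
have [Lt0 /andP[_ Lv]] := likelihood_le hcell hz Sv0 (@hD n).
apply: (le_trans Lv); rewrite ler_pM2l// ler_expR ler_pM2l//.
case: w evt => w hw evt; case/lastP: w hw evt => [//|y0 b0] hw evt.
have y0h : (size y0 < h)%N by move: (hw); rewrite size_rcons => /andP[].
apply: (@node_sum_hits_le R h Q _ _ Qt _ St Sv (fun w => hits cell z w (D n)) n q e y0 b0) => //.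
  by move=> y /Q0/ltW.
by rewrite !coordE.
Qed.

Lemma posterior_cvg_weakly :
  cvg_weakly (fun n => posterior m cell alpha u s z (D n)) (\d_ (t : borel (qvec R h))).
Proof.
have [nu nuE] := prior_finite_measure alpha0 u0 s0 h.
have above0 c : 0 < c < 1 -> (0 < nu (above h c (Defs.coord t)))%E.
  by move=> c01; rewrite nuE; exact: prior_above.
apply: cvg_weakly_dirac => [n|U oU Ut].
  (* Any value strictly between 0 and 1 serves here, where [c] is only used for the positivity of
     the evidence. *)
  have c01 : 0 < (2^-1 : R) < 1 by apply/andP; split; lra.
  have c01' : 0 < (2^-1 : R) <= 1 by apply/andP; split; lra.
  exact: (posterior_finite_measure hcell hz alpha0 u0 s0 St (@hD n) nuE c01' (above0 _ c01)).
have [e e0 eU] := qvec_open_ball oU Ut.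
have [q q0 qQ] := exists_positive_lower_bound Q0.
pose k : R := q * e ^+ 2 / 8.
have k0 : 0 < k by rewrite divr_gt0// mulr_gt0// exprn_gt0.
(* Then [c ^ h = exp (- k * h / (h + 1)) > exp (- k)]; dividing by [h + 1] rather than [h] also
   covers [h = 0]. *)
pose c : R := expR (- (k / h.+1%:R)).
have kh0 : 0 < k / h.+1%:R by rewrite divr_gt0.
have c01 : 0 < c < 1 by rewrite expR_gt0 -expR0 ltr_expR oppr_lt0.
have c01' : 0 < c <= 1 by have /andP[-> /ltW ->] := c01.
have mU : measurable (~` U : set (borel (qvec R h))).
  by apply: measurableC; exact: sub_sigma_algebra.
pose V := fine (nu (above h c (Defs.coord t))).
pose C := fine (nu setT) / V.
have V0 : 0 < V.
  rewrite fine_gt0// above0//= -ge0_fin_numE// fin_num_measure//.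
  exact: measurable_above.
have C0 : 0 <= C by rewrite divr_ge0 ?fine_ge0// ltW.
have bound n : (0 < n)%N -> err n <= k / 4 ->
    (posterior m cell alpha u s z (D n) (~` U) <= (C * expR (- (k / 2)) ^+ n)%:E)%E.
  move=> n0 ek.
  have := @posterior_le _ _ _ _ _ _ hcell _ hz _ _ _ alpha0 u0 s0 t (D n) St
    (@hD n) nu nuE c c01' (above0 _ c01) (expR (2 * (n%:R * (err n - k)))) (~` U) mU
    (expR_ge0 _).
  move=> /(_ _)/le_trans; apply.
    move=> v nUv Sv.
    have [w hw] : exists w, e <= `|v w - t w|.
      apply: contrapT => H; apply: nUv; apply: eU => w.
      by rewrite ltNge; apply/negP => hw; apply: H; exists w.
    exact: (likelihood_away_le n0 (ltW q0) (ltW e0) qQ Sv hw).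
  rewrite lee_fin /C sizeD -/V.
  have -> : expR (2 * (n%:R * (err n - k))) * fine (nu setT) / ((c ^+ h) ^+ n * V) =
      fine (nu setT) / V * (expR (2 * (n%:R * (err n - k))) * ((c ^+ h) ^+ n)^-1).
    by rewrite invfM; ring.
  rewrite ler_wpM2l// /c -!expRM_natl -expRN -expRD ler_expR.
  have n0' : 0 < n%:R :> R by rewrite ltr0n.
  (* With [err n <= k / 4] the bracket is at most [2 * (k / 4 - k) + k = - k / 2], the decay rate in
     [bound]. *)
  have -> : 2 * (n%:R * (err n - k)) - n%:R * (h%:R * - (k / h.+1%:R)) =
    n%:R * (2 * (err n - k) + k * (h%:R / h.+1%:R)) by ring.
  rewrite ler_pM2l//.
  have : k * (h%:R / h.+1%:R) <= k.
    by rewrite ler_piMr ?(ltW k0)// ler_pdivrMr// mul1r ler_nat.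
  by move: (k * _) => x; lra.
apply: (@squeeze_cvge _ _ _ _ (cst 0%E) _ (EFin \o (fun n => C * expR (- (k / 2)) ^+ n))).
- have /cvgrPdist_le := err_cvg0 => /(_ (k / 4)); rewrite divr_gt0// => /(_ isT) near_err.
  near=> n; apply/andP; split; last first.
    apply: bound; first by near: n; exact: nbhs_infty_gt.
    apply: (le_trans (ler_norm _)); rewrite -normrN -sub0r.
    by near: n.
  have [mu [muE _]] := posterior_finite_measure hcell hz alpha0 u0 s0 St (@hD n)
    nuE c01' (above0 _ c01).
  by rewrite -muE//; exact: measure_ge0.
- exact: cvg_cst.
- apply/fine_cvgP; split; first exact: nearW.
  rewrite /= -(mulr0 C); apply: cvgM; first exact: cvg_cst.
  apply: cvg_expr; rewrite ger0_norm ?expR_ge0// -expR0 ltr_expR oppr_lt0.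
  by rewrite divr_gt0.
Unshelve. all: by end_near. Qed.

End concentration.

(** * The true branching vector *)

Section true_branching.
Context (R : realType) d (Gam : measurableType d) (vol : probability Gam R).
Context (m : nat) (cell : seq bool -> set Gam).
Hypothesis hcell : tree_partition vol m cell.
Context (qdot : probability Gam R) (z : seq bool).
Let h := (m - size z)%N.
Hypothesis hdef : forall y : seq bool, (size y < h)%N -> (0 < qdot (cell (z ++ y)))%E.

Let Q y := fine (qdot (cell (z ++ y))).

Let lt_size y : (size y < h)%N -> (size (z ++ y) < m)%N.
Proof. by rewrite size_cat /h ltn_subRL. Qed.

Let Q_gt0 y : (size y < h)%N -> 0 < Q y.
Proof.
move=> yh; rewrite fine_gt0// hdef//= -ge0_fin_numE// fin_num_measure//.
exact: cell_measurable hcell _ (ltnW (lt_size yh)).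
Qed.

Lemma true_vec_coordE y b : (size y < h)%N ->
  Defs.coord (true_vec m cell qdot z : qvec R h) (rcons y b) =
  branching cell qdot (z ++ rcons y b).
Proof. by move=> yh; rewrite /Defs.coord insubT// size_rcons. Qed.

(** The child cell lies inside its parent, so the intersection in [cond_prob] is the child itself,
    and positivity of the parent mass undoes the division. *)
Lemma cell_mass_branching y b : (size y < h)%N ->
  Q (rcons y b) = Q y * Defs.coord (true_vec m cell qdot z : qvec R h) (rcons y b).
Proof.
move=> yh; rewrite true_vec_coordE// /branching /cond_prob -rcons_cat size_rcons /=.
rewrite -[rcons (z ++ y) b]cats1 take_size_cat// cats1 setIidl.
  by rewrite mulrC divfK ?gt_eqF ?Q_gt0// /Q -rcons_cat.
exact: (cell_rcons_sub hcell) (lt_size yh).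
Qed.

Lemma true_vec_sibling_sum1 :
  sibling_sum1 h (Defs.coord (true_vec m cell qdot z : qvec R h)).
Proof.
move=> y yh; have Qy := Q_gt0 yh; have zy := lt_size yh.
have mc b : measurable (cell (rcons (z ++ y) b)).
  by apply: (cell_measurable hcell); rewrite size_rcons.
have QE b := cell_mass_branching b yh.
have t0 b : 0 <= Defs.coord (true_vec m cell qdot z : qvec R h) (rcons y b).
  by rewrite -(pmulr_rge0 _ Qy) -QE fine_ge0.
have Qy0 : Q y != 0 by rewrite gt_eqF.
split=> //; apply: (mulfI Qy0); rewrite mulrDr -!QE mulr1 /Q.
rewrite (cell_split hcell zy) measureU//; last exact: (cell_disjoint hcell).
by rewrite fineD ?fin_num_measure// -!rcons_cat.
Qed.

End true_branching.

Theorem theorem5 (R : realType)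
    (d : measure_display) (Gam : measurableType d) (vol : probability Gam R)
    (m : nat) (cell : seq bool -> set Gam)
    (hcell : tree_partition vol m cell)
    (alpha u s : R) (halpha : 0 < alpha) (hu : 0 <= u) (hs : 0 <= s)
    (hus : u + s = 1)
    (qdot : probability Gam R)
    (hqdot : cellwise_constant_density vol m cell qdot)
    (z : seq bool) (hz : (size z <= m)%N)
    (* the true branching probabilities below z are defined *)
    (hdef : forall y : seq bool, (size y < m - size z)%N ->
       (0 < qdot (cell (z ++ y)))%E)
    (* in the degenerate case s = 0 the prior is the point mass at 1/2 *)
    (hdeg : s = 0 -> forall y : seq bool, (0 < size y <= m - size z)%N ->
       branching cell qdot (z ++ y) = 2^-1)
    (d' : measure_display) (Om : measurableType d') (P : probability Om R)
    (X : nat -> {RV P >-> Gam}) (hX : iid_from X qdot) :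
  {ae P, forall om : Om,
    size (restrict_data cell z (sample X n om)) @[n --> \oo] --> \oo ->
    cvg_weakly
      (fun n => posterior m cell alpha u s z (sample X n om))
      (\d_(true_vec m cell qdot z))}.
Proof.
have mc w : (size (z ++ w) <= m)%N -> measurable (cell (z ++ w)).
  exact: cell_measurable hcell _.
(* There are countably many strings, so one null set serves them all. *)
have freq : {ae P, forall om, forall w : seq bool, (size (z ++ w) <= m)%N ->
    (hits cell z w (sample X n om))%:R / n%:R @[n --> \oo] -->
    fine (qdot (cell (z ++ w)))}.
  apply: ae_forall_countable => w; have [wm|wm] := boolP (size (z ++ w) <= m)%N.
    by apply: filterS (iid_frequency_ae hX (mc _ wm)) => om.
  exact: filterE.
have null : {ae P, forall om, forall w : seq bool, (size (z ++ w) <= m)%N ->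
    qdot (cell (z ++ w)) = 0%E -> forall i, ~ cell (z ++ w) (X i om)}.
  apply: ae_forall_countable => w; have [wm|wm] := boolP (size (z ++ w) <= m)%N; last first.
    exact: filterE.
  have [q0|/eqP q0] := eqVneq (qdot (cell (z ++ w))) 0%E; last exact: filterE.
  by apply: filterS (iid_null_ae hX (mc _ wm) q0) => om.
have le_size (y : seq bool) b : (size y < m - size z)%N ->
    (size (z ++ rcons y b) <= m)%N.
  by rewrite ltn_subRL size_cat size_rcons addnS.
apply: filterS2 freq null => om freq null _.
apply: (@posterior_cvg_weakly R d Gam vol m cell hcell z hz alpha u s halpha hu hs hus
  (true_vec m cell qdot z) (fun w => fine (qdot (cell (z ++ w))))).
- move=> y yh; rewrite fine_gt0// hdef//= -ge0_fin_numE// fin_num_measure//.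
  by apply: mc; rewrite size_cat -leq_subRL// ltnW.
- by move=> y b; exact: (cell_mass_branching hcell hdef).
- exact: (true_vec_sibling_sum1 hcell hdef).
- move=> s0 y b yh; rewrite true_vec_coordE// hdeg// size_rcons yh.
  by [].
- by move=> n; rewrite size_map size_iota.
- by move=> y b yh; exact: freq (le_size y b yh).
(* A positive count exhibits a sample point in the cell, which by [null] excludes mass 0; the
   branching value is then positive as a quotient of positive masses. *)
- move=> n y b yh; rewrite -has_count => /hasP[x /mapP[i _ ->] /set_mem cx].
  have Qy : 0 < fine (qdot (cell (z ++ y))).
    rewrite fine_gt0// hdef//= -ge0_fin_numE// fin_num_measure//.
    by apply: mc; rewrite size_cat -leq_subRL// ltnW.
  rewrite -(pmulr_rgt0 _ Qy) -(cell_mass_branching hcell hdef)//.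
  have mw := mc _ (le_size y b yh).
  rewrite fine_gt0// -ge0_fin_numE// fin_num_measure// andbT lt0e measure_ge0 andbT.
  by apply/eqP => q0; exact: (null _ (le_size y b yh) q0 i).
Qed.
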